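(* Let $(X,d)$ and $(Y,\partial)$ be uniformly locally finite metric spaces, each of which coarsely embeds into a Hilbert space. If the uniform Roe algebras $\mathrm{C}^*_u(X)$ and $\mathrm{C}^*_u(Y)$ are isomorphic, then $(X,d)$ and $(Y,\partial)$ are coarsely equivalent.
   Context: Coarse structures. A coarse structure on a set $X$ is a collection $\mathcal{E}$ of subsets of $X\times X$ (called entourages) which contains the diagonal $\Delta_X=\{(x,x): x\in X\}$ and is closed under taking subsets, inverses $E^{-1}=\{(x,y):(y,x)\in E\}$, finite unions, and compositions $E\circ F=\{(x,y): \exists z\ (x,z)\in E,\ (z,y)\in F\}$; $(X,\mathcal{E})$ is a coarse space. A metric space $(X,d)$ is given its bounded coarse structure $\mathcal{E}_d$, the smallest coarse structure containing all $E_r=\{(x,y): d(x,y)\le r\}$, $r\ge 0$. A coarse space $(X,\mathcal{E})$ is uniformly locally finite if $\sup_{x\in X}|\{y\in X:(x,y)\in E\}|<\infty$ for all $E\in\mathcal{E}$; a metric space is uniformly locally finite if its bounded coarse structure is. Coarse maps. Let $(X,\mathcal{E})$, $(Y,\mathcal{F})$ be coarse spaces. Maps $f,g:Z\to X$ from a set $Z$ are close if $\{(f(z),g(z)): z\in Z\}\in\mathcal{E}$. A map $f:X\to Y$ is coarse if for all $E\in\mathcal{E}$ there is $F\in\mathcal{F}$ such that $(x,x')\in E$ implies $(f(x),f(x'))\in F$. A coarse map $f:X\to Y$ is a coarse embedding if for all $F\in\mathcal{F}$ there is $E\in\mathcal{E}$ such that $(x,x')\notin E$ implies $(f(x),f(x'))\notin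 F$. A coarse map $f:X\to Y$ is a coarse equivalence if there is a coarse map $g:Y\to X$ such that $g\circ f$ and $f\circ g$ are close to $\mathrm{Id}_X$ and $\mathrm{Id}_Y$; in that case the spaces are coarsely equivalent. A space coarsely embeds into a Hilbert space if there is a coarse embedding into some Hilbert space with the bounded coarse structure of its norm metric. Uniform Roe algebras. For $T\in B(\ell_2(X))$ let $\mathrm{supp}(T)=\{(x,x'):\langle T\delta_x,\delta_{x'}\rangle\ne 0\}$. The uniform Roe algebra $\mathrm{C}^*_u(X)$ is the norm closure in $B(\ell_2(X))$ of $\{T\in B(\ell_2(X)): \mathrm{supp}(T)\in\mathcal{E}\}$. Isomorphisms of C*-algebras are $*$-isomorphisms. *)

(* Defs.v *)
From HB Require Import structures.
From mathcomp Require Import all_boot all_order all_algebra.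
From mathcomp Require Import all_classical all_reals all_analysis.
From mathcomp Require Import complex sesquilinear lra.

Set Implicit Arguments.
Unset Strict Implicit.
Unset Printing Implicit Defensive.

Import Order.TTheory GRing.Theory Num.Theory.
Import numFieldNormedType.Exports.

Local Open Scope classical_set_scope.
Local Open Scope ring_scope.

Section CoarseStructures.
Local Open Scope relation_scope.

(* [B \; A] is the composition of A and B in the order of the coarse literature:
   the (x, y) such that (x, z) is in A and (z, y) is in B for some z. *)
Definition coarse_structure (X : Type) (E : set_system (X * X)) : Prop :=
  [/\ E diagonal,
      forall A B, B `<=` A -> E A -> E B,
      forall A, E A -> E A^-1,
      forall A B, E A -> E B -> E (A `|` B) &
      forall A B, E A -> E B -> E (B \; A)].

End CoarseStructures.

(* The distance takes its values in a numDomainType, so as to apply both to the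
   distance of a metricType over R and to the norm of a module over R[i]. *)
Definition bounded_coarse (K : numDomainType) (X : Type) (d : X -> X -> K) :
    set_system (X * X) :=
  smallest (@coarse_structure X)
    [set [set xy | d xy.1 xy.2 <= r] | r in [set r : K | 0 <= r]].

Lemma smallest_coarse_structure (X : Type) (B : set_system (X * X)) :
  coarse_structure (smallest (@coarse_structure X) B).
Proof.
split=> [E [[]]//|A C CA SA|A SA|A C SA SC|A C SA SC] E ES;
  have [[E1 E2 E3 E4 E5] _] := ES.
- by apply: E2 CA _; exact: SA ES.
- by apply: E3; exact: SA ES.
- by apply: E4; [exact: SA ES | exact: SC ES].
- by apply: E5; [exact: SA ES | exact: SC ES].
Qed.

Definition uniformly_locally_finite (X : Type) (E : set_system (X * X)) :
    Prop :=
  forall A, E A -> exists n : nat, forall x, ([set y | A (x, y)] #<= `I_n)%card.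

Definition close_maps (Z X : Type) (E : set_system (X * X)) (f g : Z -> X) : Prop :=
  E [set (f z, g z) | z in [set: Z]].

Definition coarse_map (X Y : Type) (E : set_system (X * X))
    (F : set_system (Y * Y)) (f : X -> Y) : Prop :=
  forall A, E A -> exists2 B, F B &
    forall x x', A (x, x') -> B (f x, f x').

Definition coarse_embedding (X Y : Type) (E : set_system (X * X))
    (F : set_system (Y * Y)) (f : X -> Y) : Prop :=
  coarse_map E F f /\
  forall B, F B -> exists2 A, E A &
    forall x x', ~ A (x, x') -> ~ B (f x, f x').

Definition coarse_equivalence (X Y : Type) (E : set_system (X * X))
    (F : set_system (Y * Y)) (f : X -> Y) : Prop :=
  coarse_map E F f /\
  exists g : Y -> X,
    [/\ coarse_map F E g,
        close_maps E (g \o f) id &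
        close_maps F (f \o g) id].

Definition coarsely_equivalent (X Y : Type) (E : set_system (X * X))
    (F : set_system (Y * Y)) : Prop :=
  exists f : X -> Y, coarse_equivalence E F f.

(* A complex Hilbert space is a complete normed module over R[i] whose norm
   comes from an inner product (linear on the left). *)
Definition coarsely_embeds_in_Hilbert (R : realType) (X : Type)
    (E : set_system (X * X)) : Prop :=
  exists (H : completeNormedModType R[i]) (dot : {dot H for Num.conj}),
    (forall u : H, `|u| ^+ 2 = dot u u) /\
    exists f : X -> H,
      coarse_embedding E (bounded_coarse (fun u v : H => `|u - v|)) f.

Section Sums.
Variables (R : realType) (X : choiceType).
Implicit Types (a b : X -> R) (f g : X -> R[i]).

Let funrposE a x : a^\+ x = Num.max (a x) 0. Proof. by []. Qed.

Let funrnegE a x : a^\- x = Num.max (- a x) 0. Proof. by []. Qed.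

Definition nnsum a : R := fine (\esum_(x in [set: X]) (a x)%:E).

(* Unconditional sums of absolutely summable families; the value is
   meaningless otherwise. *)
Definition rsum a : R := nnsum a^\+ - nnsum a^\-.

Definition csum f : R[i] :=
  Complex (rsum (fun x => complex.Re (f x))) (rsum (fun x => complex.Im (f x))).

Definition nnsummable a : Prop := (\esum_(x in [set: X]) (a x)%:E < +oo)%E.

Definition rsummable a : Prop := nnsummable (fun x => `|a x|).

Lemma nnsummable_le a b :
  (forall x, a x <= b x) -> nnsummable b -> nnsummable a.
Proof.
by move=> ab; apply: le_lt_trans; apply: le_esum => x _; rewrite lee_fin.
Qed.

Lemma nnsummable_fin a :
  (forall x, 0 <= a x) -> nnsummable a ->
  \esum_(x in [set: X]) (a x)%:E = (nnsum a)%:E.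
Proof.
move=> a0 fa; rewrite /nnsum fineK// ge0_fin_numE//.
by apply: esum_ge0 => x _; rewrite lee_fin.
Qed.

Lemma esumD_EFin a b : (forall x, 0 <= a x) -> (forall x, 0 <= b x) ->
  (\esum_(x in [set: X]) (a x + b x)%:E =
   \esum_(x in [set: X]) (a x)%:E + \esum_(x in [set: X]) (b x)%:E)%E.
Proof.
by move=> a0 b0; rewrite -esumD// => x _; rewrite lee_fin.
Qed.

Lemma nnsummableD a b : (forall x, 0 <= a x) -> (forall x, 0 <= b x) ->
  nnsummable a -> nnsummable b -> nnsummable (fun x => a x + b x).
Proof.
by move=> a0 b0 fa fb; rewrite /nnsummable esumD_EFin// lte_add_pinfty.
Qed.

Lemma nnsumD a b : (forall x, 0 <= a x) -> (forall x, 0 <= b x) ->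
  nnsummable a -> nnsummable b ->
  nnsum (fun x => a x + b x) = nnsum a + nnsum b.
Proof.
move=> a0 b0 fa fb; apply: EFin_inj.
rewrite -nnsummable_fin//; last 2 first.
- by move=> x; rewrite addr_ge0.
- exact: nnsummableD.
by rewrite esumD_EFin// EFinD !nnsummable_fin.
Qed.

Lemma nnsum_ge0 a : (forall x, 0 <= a x) -> 0 <= nnsum a.
Proof.
by move=> a0; apply: fine_ge0; apply: esum_ge0 => x _; rewrite lee_fin.
Qed.

Lemma nnsum_ge a x : (forall x, 0 <= a x) -> nnsummable a -> a x <= nnsum a.
Proof.
move=> a0 fa; rewrite -lee_fin -nnsummable_fin//.
apply: esum_ge; exists [set x]; first by split=> //; exact: finite_set1.
by rewrite fsbig_set1.
Qed.

Let esumZ_le (c : R) a : 0 <= c -> (forall x, 0 <= a x) -> nnsummable a ->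
  (\esum_(x in [set: X]) (c * a x)%:E <= (c * nnsum a)%:E)%E.
Proof.
move=> c0 a0 fa; apply: ge_ereal_sup => _ [A [finA _] <-].
under eq_fsbigr do rewrite EFinM.
rewrite -ge0_mule_fsumr; last by move=> x; rewrite lee_fin.
rewrite [leRHS]EFinM lee_wpmul2l ?lee_fin// -nnsummable_fin//.
by apply: esum_ge; exists A.
Qed.

Lemma nnsummableZ (c : R) a : 0 <= c -> (forall x, 0 <= a x) ->
  nnsummable a -> nnsummable (fun x => c * a x).
Proof. by move=> c0 a0 fa; apply: le_lt_trans (esumZ_le c0 a0 fa) (ltry _). Qed.

Lemma nnsumZ (c : R) a : 0 <= c -> (forall x, 0 <= a x) -> nnsummable a ->
  nnsum (fun x => c * a x) = c * nnsum a.
Proof.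
move=> c0 a0 fa; have ca0 x : 0 <= c * a x by rewrite mulr_ge0.
have fca := nnsummableZ c0 a0 fa.
apply/eqP; rewrite eq_le; apply/andP; split.
  by rewrite -lee_fin -nnsummable_fin// esumZ_le.
have [->|cN0] := eqVneq c 0.
  by rewrite mul0r nnsum_ge0// => x; rewrite mul0r.
have cp : 0 < c by rewrite lt_def cN0.
rewrite -ler_pdivlMl// -lee_fin -[leLHS]nnsummable_fin//.
under eq_esum => x _ do rewrite -[a x](mulKf cN0).
by apply: esumZ_le; rewrite ?invr_ge0.
Qed.

Lemma rsum_diff a b : (forall x, 0 <= a x) -> (forall x, 0 <= b x) ->
  nnsummable a -> nnsummable b ->
  rsum (fun x => a x - b x) = nnsum a - nnsum b.
Proof.
move=> a0 b0 fa fb; set f := fun x => a x - b x.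
have fp0 x : 0 <= f^\+ x by rewrite funrposE le_max lexx orbT.
have fn0 x : 0 <= f^\- x by rewrite funrnegE le_max lexx orbT.
have fpE : nnsummable f^\+.
  apply: nnsummable_le fa => x; rewrite funrposE ge_max a0 andbT /f.
  by rewrite gerBl.
have fnE : nnsummable f^\-.
  apply: nnsummable_le fb => x; rewrite funrnegE ge_max b0 andbT /f.
  by rewrite opprB gerBl.
rewrite /rsum; apply/eqP; rewrite subr_eq addrAC eq_sym subr_eq -!nnsumD//.
apply/eqP; congr nnsum; apply/funext => x.
rewrite funrposE funrnegE /f.
by case: (leP (a x - b x) 0) => h1; case: (leP (- (a x - b x)) 0) => h2; lra.
Qed.

Lemma rsum_nnsum a : (forall x, 0 <= a x) -> rsum a = nnsum a.
Proof.
move=> a0; rewrite /rsum (_ : a^\+ = a); last first.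
  by apply/funext => x; rewrite funrposE max_l.
rewrite (_ : a^\- = fun=> 0).
  by rewrite /nnsum [in X in _ - X]esum1// subr0.
by apply/funext => x; rewrite funrnegE max_r// oppr_le0.
Qed.

Let pos_summable a : rsummable a -> nnsummable a^\+.
Proof.
by apply: nnsummable_le => x; rewrite funrposE ge_max ler_norm normr_ge0.
Qed.

Let neg_summable a : rsummable a -> nnsummable a^\-.
Proof.
apply: nnsummable_le => x.
by rewrite funrnegE ge_max -normrN ler_norm normr_ge0.
Qed.

Let pos_ge0 a x : 0 <= a^\+ x.
Proof. by rewrite funrposE le_max lexx orbT. Qed.

Let neg_ge0 a x : 0 <= a^\- x.
Proof. by rewrite funrnegE le_max lexx orbT. Qed.

Let posBneg a x : a x = a^\+ x - a^\- x.
Proof.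
rewrite funrposE funrnegE.
by case: (leP (a x) 0) => h1; case: (leP (- a x) 0) => h2; lra.
Qed.

Lemma rsummableD a b :
  rsummable a -> rsummable b -> rsummable (fun x => a x + b x).
Proof.
move=> fa fb; apply: (@nnsummable_le _ (fun x => `|a x| + `|b x|)).
  by move=> x; exact: ler_normD.
exact: nnsummableD.
Qed.

Lemma rsumD a b : rsummable a -> rsummable b ->
  rsum (fun x => a x + b x) = rsum a + rsum b.
Proof.
move=> fa fb.
rewrite (_ : (fun x => _) =
    fun x => (a^\+ x + b^\+ x) - (a^\- x + b^\- x)); last first.
  by apply/funext => x; rewrite {1}(posBneg a) {1}(posBneg b) opprD addrACA.
have [fp fn] := (pos_summable fa, neg_summable fa).
have [gp gn] := (pos_summable fb, neg_summable fb).
rewrite rsum_diff.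
- by rewrite !nnsumD// opprD addrACA.
- by move=> x; rewrite addr_ge0.
- by move=> x; rewrite addr_ge0.
- exact: nnsummableD.
- exact: nnsummableD.
Qed.

Lemma rsumN a : rsum (fun x => - a x) = - rsum a.
Proof.
rewrite /rsum opprB -[X in X^\+]/(\- a) -[X in X^\-]/(\- a).
by rewrite funrposN funrnegN.
Qed.

Lemma rsummableZ (c : R) a : rsummable a -> rsummable (fun x => c * a x).
Proof.
move=> fa; rewrite /rsummable (_ : (fun x => _) = fun x => `|c| * `|a x|).
  exact: nnsummableZ.
by apply/funext => x; rewrite normrM.
Qed.

Lemma rsumZ (c : R) a : rsummable a -> rsum (fun x => c * a x) = c * rsum a.
Proof.
move=> fa; wlog c0 : c / 0 <= c => [hw|].
  have [/hw//|c0] := leP 0 c.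
  rewrite -[c]opprK mulNr -hw ?oppr_ge0 ?ltW// -rsumN.
  by congr rsum; apply/funext => x; rewrite !mulNr opprK.
rewrite (_ : (fun x => _) = fun x => c * a^\+ x - c * a^\- x); last first.
  by apply/funext => x; rewrite -mulrBr -posBneg.
have [fp fn] := (pos_summable fa, neg_summable fa).
rewrite rsum_diff.
- by rewrite !nnsumZ// -mulrBr.
- by move=> x; rewrite mulr_ge0.
- by move=> x; rewrite mulr_ge0.
- exact: nnsummableZ.
- exact: nnsummableZ.
Qed.

Definition csummable f : Prop :=
  rsummable (fun x => complex.Re (f x)) /\ rsummable (fun x => complex.Im (f x)).

Lemma csumD f g : csummable f -> csummable g ->
  csum (fun x => f x + g x) = csum f + csum g.
Proof.
move=> [f1 f2] [g1 g2].
rewrite /csum -[RHS]/(Complex (_ + _) (_ + _)) -!rsumD//.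
by congr Complex; congr rsum; apply/funext => x; case: (f x); case: (g x).
Qed.

Lemma csumZ (c : R[i]) f : csummable f -> csum (fun x => c * f x) = c * csum f.
Proof.
case: c => c d [f1 f2].
rewrite /csum -[RHS]/(Complex (_ * _ - _ * _) (_ * _ + _ * _)).
have df2 : rsummable (fun x => - (d * complex.Im (f x))).
  by rewrite /rsummable; under eq_fun do rewrite normrN; exact: rsummableZ.
rewrite -!rsumZ// -rsumN -!rsumD//; try exact: rsummableZ.
by congr Complex; congr rsum; apply/funext => x; case: (f x).
Qed.

Lemma csum_conj f : csum (fun x => (f x)^*) = (csum f)^*.
Proof.
rewrite /csum -[RHS]/(Complex _ (- _)) -rsumN.
by congr Complex; congr rsum; apply/funext => x; case: (f x).
Qed.

End Sums.

Section CauchySchwarz.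
Variables (C : numClosedFieldType) (V : lmodType C) (dot : {dot V for Num.conj}).

Lemma dot_CauchySchwarz (u v : V) : `|dot u v| ^+ 2 <= dot u u * dot v v.
Proof.
have [->|v0] := eqVneq v 0; first by rewrite !linear0r normr0 expr0n.
have vp : 0 < dot v v by rewrite dnorm_gt0.
have := dnorm_ge0 dot (dot v v *: u - dot u v *: v).
rewrite dnormB !dnormZ linearZr_LR (linearZl_LR dot) /= mulrCA -normCKC.
rewrite (ger0_norm (ltW vp)) geC0_conj ?mulr_ge0 ?exprn_ge0 ?(ltW vp)//.
rewrite [X in _ + X - _]mulrC opprD addrA addrK expr2 -mulrA -mulrBr.
by rewrite pmulr_rge0// subr_ge0 mulrC.
Qed.

Lemma sqrt_dotD (u v : V) :
  sqrtC (dot (u + v) (u + v)) <= sqrtC (dot u u) + sqrtC (dot v v).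
Proof.
have uu0 : 0 <= dot u u by exact: dnorm_ge0.
have vv0 : 0 <= dot v v by exact: dnorm_ge0.
rewrite -ler_sqr ?nnegrE ?addr_ge0 ?sqrtC_ge0 ?dnorm_ge0//.
rewrite sqrrD !sqrtCK dnormD [leRHS]addrAC lerD2l.
have duv : `|dot u v| <= sqrtC (dot u u) * sqrtC (dot v v).
  rewrite -ler_sqr ?nnegrE ?mulr_ge0 ?sqrtC_ge0//.
  by rewrite exprMn !sqrtCK dot_CauchySchwarz.
apply: (@le_trans _ _ (`|dot u v| *+ 2)); last by rewrite lerMn2r.
apply: (@le_trans _ _ `|dot u v + (dot u v)^*|).
  by rewrite real_ler_norm// CrealE rmorphD /= conjCK addrC.
by rewrite (le_trans (ler_normD _ _))// norm_conjC mulr2n.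
Qed.

End CauchySchwarz.

Section SquareSummable.
Variables (R : realType) (X : choiceType).
Implicit Types (c : R[i]) (f g : X -> R[i]).

Definition square_summable : {pred X -> R[i]} :=
  [pred f | `[< nnsummable (fun x => complex.Re (`|f x| ^+ 2)) >]].

Let sqE (z : R[i]) :
  complex.Re (`|z| ^+ 2) = complex.Re z ^+ 2 + complex.Im z ^+ 2.
Proof. by rewrite -add_Re2_Im2. Qed.

Let sq_ge0 (z : R[i]) : 0 <= complex.Re (`|z| ^+ 2).
Proof. by rewrite sqE addr_ge0 ?sqr_ge0. Qed.

Let sqZ (w z : R[i]) :
  complex.Re (`|w * z| ^+ 2) = complex.Re (`|w| ^+ 2) * complex.Re (`|z| ^+ 2).
Proof. by rewrite !sqE; case: w z => a b [c d]; rewrite /=; lra. Qed.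

Let sqD (w z : R[i]) : complex.Re (`|w + z| ^+ 2) <=
  2 * complex.Re (`|w| ^+ 2) + 2 * complex.Re (`|z| ^+ 2).
Proof.
rewrite !sqE; case: w z => a b [c d]; rewrite /=.
by have := sqr_ge0 (a - c); have := sqr_ge0 (b - d); lra.
Qed.

Lemma square_summableP f :
  reflect (nnsummable (fun x => complex.Re (`|f x| ^+ 2))) (f \in square_summable).
Proof. exact: asboolP. Qed.

Lemma square_summable_submod_closed : submod_closed square_summable.
Proof.
split=> [|c f g /square_summableP sf /square_summableP sg];
    apply/square_summableP.
  rewrite /nnsummable esum1 ?ltry// => x _.
  by rewrite [X in `|X|](_ : _ = 0)// normr0 expr0n.
have s1 : nnsummable (fun x => 2 * (complex.Re (`|c| ^+ 2) *
    complex.Re (`|f x| ^+ 2)) + 2 * complex.Re (`|g x| ^+ 2)).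
  apply: nnsummableD.
  - by move=> x; rewrite !mulr_ge0.
  - by move=> x; rewrite mulr_ge0.
  - apply: nnsummableZ => // [x|]; first by rewrite mulr_ge0.
    exact: nnsummableZ.
  - exact: nnsummableZ.
apply: nnsummable_le s1 => x; rewrite -sqZ.
exact: sqD.
Qed.

HB.instance Definition _ := GRing.isSubmodClosed.Build R[i] (X -> R[i])
  square_summable square_summable_submod_closed.

Record l2 := L2 { l2_fun :> X -> R[i]; _ : l2_fun \in square_summable }.

HB.instance Definition _ := [isSub for l2_fun].
HB.instance Definition _ := [Choice of l2 by <:].
HB.instance Definition _ := [SubChoice_isSubLmodule of l2 by <:].

Implicit Types u v w : l2.

Lemma l2_summable u : nnsummable (fun x => complex.Re (`|u x| ^+ 2)).
Proof. exact/square_summableP/(valP u). Qed.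

Let prod_summable u v : csummable (fun x => u x * (v x)^*).
Proof.
have s : nnsummable (fun x =>
    complex.Re (`|u x| ^+ 2) + complex.Re (`|v x| ^+ 2)).
  by apply: nnsummableD => //; exact: l2_summable.
split; apply: nnsummable_le s => x; rewrite !sqE; case: (u x) => a b;
  case: (v x) => c d /=; rewrite ler_norml;
  have := sqr_ge0 (a + c); have := sqr_ge0 (b + d); have := sqr_ge0 (a - c);
  have := sqr_ge0 (b - d); have := sqr_ge0 (a + d); have := sqr_ge0 (b + c);
  have := sqr_ge0 (a - d); have := sqr_ge0 (b - c) => *; apply/andP; split; lra.
Qed.

Definition l2_dot u v : R[i] := csum (fun x => u x * (v x)^*).

Let l2_dotC u v : l2_dot u v = (l2_dot v u)^*.
Proof.
rewrite /l2_dot -csum_conj; congr csum; apply/funext => x.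
by rewrite rmorphM /= conjCK mulrC.
Qed.

Let l2_dot_linearl v : linear_for *%R (l2_dot^~ v).
Proof.
move=> c u w; rewrite /l2_dot -csumZ// -csumD.
- by congr csum; apply/funext => x; rewrite mulrA -mulrDl.
- rewrite (_ : (fun x => _) = fun x => (c *: u : l2) x * (v x)^*)//.
  by apply/funext => x; rewrite mulrA.
- exact: prod_summable.
Qed.

Let l2_dot_linearr u : linear_for (Num.conj \; *%R) (l2_dot u).
Proof.
move=> c v w; rewrite l2_dotC l2_dot_linearl rmorphD rmorphM /=.
by rewrite -!l2_dotC.
Qed.

Let l2_dot_bilinear : bilinear_for (GRing.Scale.Law.clone _ _ *%R _)
  (GRing.Scale.Law.clone _ _ (Num.conj \; *%R) _) l2_dot.
Proof. by split; [exact: l2_dot_linearl | exact: l2_dot_linearr]. Qed.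

HB.instance Definition _ := bilinear_isBilinear.Build R[i] l2 l2 R[i]
  _ _ l2_dot l2_dot_bilinear.

Let l2_dot_hermitian u v : l2_dot u v = (-1) ^+ false * (l2_dot v u)^*.
Proof. by rewrite expr0 mul1r. Qed.

HB.instance Definition _ :=
  isHermitianSesquilinear.Build R[i] l2 false Num.conj l2_dot l2_dot_hermitian.

Lemma l2_dotE u :
  l2_dot u u = (nnsum (fun x => complex.Re (`|u x| ^+ 2)))%:C%C.
Proof.
rewrite /l2_dot /csum; congr Complex.
  rewrite -rsum_nnsum//; congr rsum; apply/funext => x.
  by rewrite normCK.
rewrite (_ : (fun x => _) = fun=> 0).
  rewrite rsum_nnsum// /nnsum esum1//.
by apply/funext => x; rewrite -normCK -add_Re2_Im2.
Qed.

Let l2_dot_gt0 u : u != 0 -> 0 < l2_dot u u.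
Proof.
move=> u0; rewrite l2_dotE ltcR.
have [x ux] : exists x, u x != 0.
  apply: contrapT => h; move/eqP: u0; apply; apply/val_inj/funext => x.
  by apply/eqP/negPn/negP => ux; apply: h; exists x.
apply: lt_le_trans (nnsum_ge x _ (l2_summable u)) => //.
by rewrite -ltcR sqE add_Re2_Im2 exprn_gt0 ?normr_gt0.
Qed.

HB.instance Definition _ :=
  isDotProduct.Build R[i] l2 l2_dot l2_dot_gt0.

Let l2_norm u : R[i] := sqrtC (l2_dot u u).

Let l2_normD u v : l2_norm (u + v) <= l2_norm u + l2_norm v.
Proof. exact: sqrt_dotD. Qed.

Let l2_normZ c u : l2_norm (c *: u) = `|c| * l2_norm u.
Proof.
have u0 : 0 <= l2_dot u u by exact: (dnorm_ge0 l2_dot).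
rewrite /l2_norm (dnormZ l2_dot) sqrtCM ?nnegrE ?exprn_ge0//.
by rewrite (@sqrCK R[i]).
Qed.

Let l2_norm_eq0 u : l2_norm u = 0 -> u = 0.
Proof. by move=> /eqP; rewrite (sqrt_dnorm_eq0 l2_dot) => /eqP. Qed.

HB.instance Definition _ :=
  Lmodule_isNormed.Build R[i] l2 l2_normD l2_normZ l2_norm_eq0.

Lemma sqr_l2_norm u : `|u| ^+ 2 = l2_dot u u.
Proof. exact: sqrtCK. Qed.

Definition delta_fun (x : X) : X -> R[i] := fun y => (y == x)%:R.

Lemma delta_square_summable x : delta_fun x \in square_summable.
Proof.
apply/square_summableP.
have E : \esum_(y in [set: X]) (complex.Re (`|delta_fun x y| ^+ 2))%:E =
         \esum_(y in [set x]) (1 : \bar R)%E.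
  rewrite [RHS]esum_mkcond; apply: eq_esum => y _; rewrite /delta_fun.
  have [->|yx] := eqVneq y x; first by rewrite normr1 expr1n mem_set.
  by rewrite normr0 expr0n memNset// => /eqP; rewrite (negbTE yx).
by rewrite /nnsummable E esum_set1 ?ltry// lee_fin.
Qed.

Definition delta (x : X) : l2 := L2 (delta_square_summable x).

End SquareSummable.

(* Bounded operators on V are the functions V -> V in this set; the algebraic
   operations on them are the pointwise sum and scaling, and composition. *)
Definition bounded_operator (R : realType) (V : normedModType R[i]) :
    set (V -> V) :=
  [set T | linear T /\ exists M : R, forall u, `|T u| <= M%:C%C * `|u|].

Definition opnorm (R : realType) (V : normedModType R[i]) (T : V -> V) : R :=
  sup [set complex.Re `|T u| | u in [set u | `|u| <= 1]].

Definition is_adjoint (R : realType) (V : lmodType R[i])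
    (dot : {dot V for Num.conj}) (T S : V -> V) : Prop :=
  forall u v, dot (T u) v = dot u (S v).

(* A and B are meant to be self-adjoint algebras of bounded operators: the
   adjoint of an element of A is then the unique T in A such that
   [is_adjoint dotV S T], and the last clause reads phi (S^* ) = (phi S)^*. Only
   the restriction of phi to A matters. *)
Definition star_isomorphism (R : realType) (V W : lmodType R[i])
    (dotV : {dot V for Num.conj}) (dotW : {dot W for Num.conj})
    (A : set (V -> V)) (B : set (W -> W)) (phi : (V -> V) -> (W -> W)) : Prop :=
  [/\ set_bij A B phi,
      forall S T, A S -> A T -> phi (S \+ T) = phi S \+ phi T,
      forall (c : R[i]) T, A T -> phi (c \*: T) = c \*: phi T,
      forall S T, A S -> A T -> phi (S \o T) = phi S \o phi T &
      forall S T, A S -> A T -> is_adjoint dotV S T ->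
        is_adjoint dotW (phi S) (phi T)].

Section UniformRoe.
Variables (R : realType) (X : choiceType) (E : set_system (X * X)).

Definition supp (T : l2 R X -> l2 R X) : set (X * X) :=
  [set xx | l2_dot (T (delta R xx.1)) (delta R xx.2) != 0].

Definition uniform_roe : set (l2 R X -> l2 R X) :=
  [set T | bounded_operator T /\
    forall e : R, 0 < e ->
      exists S, [/\ bounded_operator S, E (supp S) & opnorm (T \- S) < e]].

End UniformRoe.

Definition metric_coarse (R : realType) (X : metricType R) :
    set_system (X * X) :=
  bounded_coarse (@mdist R X).

Arguments metric_coarse {R} X _.

Definition uniform_roe_isomorphic (R : realType) (X Y : metricType R) : Prop :=
  exists phi, star_isomorphism (@l2_dot R X) (@l2_dot R Y)
    (uniform_roe (metric_coarse X)) (uniform_roe (metric_coarse Y)) phi.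

(* Main.v *)
(* An isomorphism of uniform Roe algebras is conjugation by a unitary U with
   inverse V. A gliding hump argument shows that V 1_A U delta_x, for A a subset
   of Y, is supported in a ball about x up to a small error, with the same radius
   for all x and A. This forces a coordinate of U delta_x at some point f x to be
   bounded below (otherwise a choice of signs on the coordinates of U delta_x
   makes its image under V too small), and then, by the same tightness for
   U 1_{x} V, the vector U delta_x is concentrated near f x uniformly in x. Hence
   f is coarse, and it is inverse up to closeness to the map g obtained from V in
   the same way. *)
Require Import Defs.
From mathcomp Require Import all_boot all_order all_algebra.
From mathcomp Require Import all_classical all_reals all_analysis.
From mathcomp Require Import complex sesquilinear lra.

Set Implicit Arguments.
Unset Strict Implicit.
Unset Printing Implicit Defensive.

Import Order.TTheory GRing.Theory Num.Theory.
Import numFieldNormedType.Exports.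

Local Open Scope classical_set_scope.
Local Open Scope ring_scope.

(** * Norms and restrictions in l2 *)

(** Approximants of bounded propagation give each single operator of the Roe algebra one radius of
    tightness valid at all points. The obstacle is uniformity over [A]: this radius depends on [A],
    while the existence of a peak is tested on sign sets that vary with [x]. The way out is that the
    algebra contains the projection onto every subset, infinite ones included, so that bad finite
    pieces found at ever larger radii can be glued into one set whose operator would fail to be
    tight. A peak alone does not make [f] coarse, since a lower bound on one coordinate of
    [U delta_x] says nothing about the rest of the vector. Concentration supplies the rest: the
    matrix coefficients of an operator of bounded propagation between [U delta_x] and [U delta_x']
    are then small as soon as [f x] and [f x'] are far apart. *)

Section RealNorm.
Variables (R : realType) (V : normedZmodType R[i]).
Implicit Types u v : V.

(** Norms over [R[i]] are complex numbers. Estimates are carried out on this real version, where the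
    order is total and [lra] applies. *)
Definition rnorm u : R := complex.Re `|u|.

Lemma rnormE u : `|u| = (rnorm u)%:C%C.
Proof. by rewrite RRe_real// normr_real. Qed.

Lemma rnormX u : `|u| ^+ 2 = (rnorm u ^+ 2)%:C%C.
Proof. by rewrite rnormE rmorphXn. Qed.

Lemma rnorm_ge0 u : 0 <= rnorm u.
Proof. by rewrite -lecR -rnormE normr_ge0. Qed.

Lemma rnormD u v : rnorm (u + v) <= rnorm u + rnorm v.
Proof. by rewrite -lecR rmorphD /= -!rnormE ler_normD. Qed.

Lemma rnormN u : rnorm (- u) = rnorm u.
Proof. by rewrite /rnorm normrN. Qed.

Lemma rnormB u v : rnorm (u - v) <= rnorm u + rnorm v.
Proof. by rewrite -(rnormN v) rnormD. Qed.

Lemma rnorm0 : rnorm 0 = 0.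
Proof. by rewrite /rnorm normr0. Qed.

Lemma rnorm_eq0 u : (rnorm u == 0) = (u == 0).
Proof. by rewrite -[RHS]normr_eq0 rnormE -(inj_eq (@complexI R)). Qed.

End RealNorm.

Section ComplexRnorm.
Variable R : realType.
Implicit Type c : R[i].

Lemma rnorm1 : rnorm (1 : R[i]) = 1.
Proof. by rewrite /rnorm normr1. Qed.

Lemma rnormCK c : rnorm c ^+ 2 = complex.Re (`|c| ^+ 2).
Proof. by rewrite rnormX. Qed.

Lemma rnorm_conj c : rnorm c^* = rnorm c.
Proof. by rewrite /rnorm norm_conjC. Qed.

Lemma rnormZ (V : normedModType R[i]) c (v : V) :
  rnorm (c *: v) = rnorm c * rnorm v.
Proof. by apply: (@complexI R); rewrite rmorphM /= -!rnormE normrZ. Qed.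

End ComplexRnorm.

Section L2Norm.
Variables (R : realType) (X : choiceType).
Implicit Types (u v w : l2 R X) (x : X) (c : R[i]) (A B : set X).

Lemma l2P u v : (forall x, u x = v x) -> u = v.
Proof. by move=> uv; apply/val_inj/funext. Qed.

Lemma l2D u v x : (u + v) x = u x + v x. Proof. by []. Qed.
Lemma l2B u v x : (u - v) x = u x - v x. Proof. by []. Qed.
Lemma l2Z c u x : (c *: u) x = c * u x. Proof. by []. Qed.
Lemma l20 x : (0 : l2 R X) x = 0. Proof. by []. Qed.

Lemma l2_sum I (s : seq I) (P : pred I) (F : I -> l2 R X) x :
  (\sum_(i <- s | P i) F i) x = \sum_(i <- s | P i) F i x.
Proof.
by elim/big_rec2: _ => // i a b _ <-; rewrite l2D.
Qed.

Lemma deltaE x y : delta R x y = (y == x)%:R. Proof. by []. Qed.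

Lemma summable_sqr u : nnsummable (fun x => rnorm (u x) ^+ 2).
Proof.
rewrite (_ : (fun x => _) = fun x => complex.Re (`|u x| ^+ 2)).
  exact: l2_summable.
by apply/funext => x; exact: rnormCK.
Qed.

Lemma rnorm_sqr u : rnorm u ^+ 2 = nnsum (fun x => rnorm (u x) ^+ 2).
Proof.
rewrite -[LHS]/(complex.Re ((rnorm u ^+ 2)%:C%C)) -rnormX.
rewrite sqr_l2_norm l2_dotE/=; congr nnsum; apply/funext => x.
exact/esym/rnormCK.
Qed.

(** An [esum] is a supremum over finite sets. All later norm bounds are reduced by this to sums over
    duplicate-free sequences. *)
Lemma nnsum_sup (a : X -> R) (m : R) : (forall x, 0 <= a x) -> 0 <= m ->
  (forall s : seq X, uniq s -> \sum_(x <- s) a x <= m) ->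
  nnsummable a /\ nnsum a <= m.
Proof.
move=> a0 m0 am.
have h : (\esum_(x in [set: X]) (a x)%:E <= m%:E)%E.
  apply: ge_ereal_sup => _ [A [finA _] <-].
  by rewrite fsbig_finite//= sumEFin lee_fin am// finmap.fset_uniq.
have s : nnsummable a by apply: le_lt_trans h (ltry _).
by split=> //; rewrite -lee_fin -nnsummable_fin.
Qed.

Lemma nnsum_ge_sum (a : X -> R) (s : seq X) : (forall x, 0 <= a x) ->
  nnsummable a -> uniq s -> \sum_(x <- s) a x <= nnsum a.
Proof.
move=> a0 fa us; rewrite -lee_fin -nnsummable_fin//.
apply: esum_ge; exists [set` s]; first by split => //; exact: finite_seq.
by rewrite -fsbig_seq//= sumEFin.
Qed.

Lemma nnsum_lt_sum (a : X -> R) (m : R) : (forall x, 0 <= a x) ->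
  nnsummable a -> m < nnsum a ->
  exists2 s : seq X, uniq s & m < \sum_(x <- s) a x.
Proof.
move=> a0 fa ma; apply: contrapT => h.
have m0 : 0 <= m.
  rewrite leNgt; apply/negP => m0; apply: h; exists [::] => //.
  by rewrite big_nil.
have [|_] := @nnsum_sup a m a0 m0; last by rewrite leNgt ma.
by move=> s us; rewrite leNgt; apply/negP => ms; apply: h; exists s.
Qed.

Lemma in_l2 (f : X -> R[i]) (m : R) : 0 <= m ->
  (forall s : seq X, uniq s -> \sum_(x <- s) rnorm (f x) ^+ 2 <= m) ->
  f \in @square_summable R X.
Proof.
move=> m0 h; apply/square_summableP.
rewrite (_ : (fun x => _) = fun x => rnorm (f x) ^+ 2); last first.
  by apply/funext => x; exact/esym/rnormCK.
have f0 x : 0 <= rnorm (f x) ^+ 2 by exact: sqr_ge0.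
by have [] := nnsum_sup f0 m0 h.
Qed.

Lemma rnorm_sqr_le u (m : R) : 0 <= m ->
  (forall s : seq X, uniq s -> \sum_(x <- s) rnorm (u x) ^+ 2 <= m) ->
  rnorm u ^+ 2 <= m.
Proof.
move=> m0 h; rewrite rnorm_sqr.
have [|||//] := @nnsum_sup (fun x => rnorm (u x) ^+ 2) m.
- by move=> x; exact: sqr_ge0.
- exact: m0.
- exact: h.
Qed.

Lemma rnorm_le_sum u (m : R) : 0 <= m ->
  (forall s : seq X, uniq s -> \sum_(x <- s) rnorm (u x) ^+ 2 <= m ^+ 2) ->
  rnorm u <= m.
Proof.
move=> m0 h; rewrite -ler_sqr ?nnegrE ?rnorm_ge0//.
by apply: rnorm_sqr_le h; exact: sqr_ge0.
Qed.

Lemma sum_le_rnorm u (s : seq X) : uniq s ->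
  \sum_(x <- s) rnorm (u x) ^+ 2 <= rnorm u ^+ 2.
Proof.
move=> us; rewrite rnorm_sqr; apply: nnsum_ge_sum us.
- by move=> x; exact: sqr_ge0.
- exact: summable_sqr.
Qed.

Lemma rnorm_le u v :
  (forall x, rnorm (u x) <= rnorm (v x)) -> rnorm u <= rnorm v.
Proof.
move=> uv; apply: rnorm_le_sum; first exact: rnorm_ge0.
move=> s us; apply: le_trans (sum_le_rnorm v us).
by apply: ler_sum => x _; rewrite ler_sqr ?nnegrE ?rnorm_ge0.
Qed.

Lemma rnorm_coord u x : rnorm (u x) <= rnorm u.
Proof.
rewrite -ler_sqr ?nnegrE ?rnorm_ge0//.
by have := @sum_le_rnorm u [:: x] isT; rewrite big_seq1.
Qed.

Lemma rnorm_dot u v : rnorm (l2_dot u v) <= rnorm u * rnorm v.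
Proof.
rewrite -ler_sqr ?nnegrE ?mulr_ge0 ?rnorm_ge0// exprMn.
have : `|l2_dot u v| ^+ 2 <= l2_dot u u * l2_dot v v.
  exact: (dot_CauchySchwarz (@l2_dot R X)).
by rewrite -!sqr_l2_norm !rnormX -rmorphM lecR.
Qed.

Lemma l2_dotC u v : l2_dot u v = (l2_dot v u)^*.
Proof. by rewrite (hermC (@l2_dot R X))/= expr0 mul1r. Qed.

Lemma l2_dotDl u v w : l2_dot (u + v) w = l2_dot u w + l2_dot v w.
Proof. exact: (linearDl (@l2_dot R X)). Qed.

Lemma l2_dotDr u v w : l2_dot u (v + w) = l2_dot u v + l2_dot u w.
Proof. exact: (linearDr (@l2_dot R X)). Qed.

Lemma l2_dotZl c u v : l2_dot (c *: u) v = c * l2_dot u v.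
Proof. exact: (linearZl_LR (@l2_dot R X)). Qed.

Lemma l2_dotZr c u v : l2_dot u (c *: v) = c^* * l2_dot u v.
Proof. exact: (linearZr_LR (@l2_dot R X)). Qed.

Lemma dot_rnorm u : l2_dot u u = (rnorm u ^+ 2)%:C%C.
Proof. by rewrite -sqr_l2_norm rnormX. Qed.

Lemma parallelogram u v :
  rnorm (u + v) ^+ 2 + rnorm (u - v) ^+ 2 = 2 * rnorm u ^+ 2 + 2 * rnorm v ^+ 2.
Proof.
have E w : rnorm w ^+ 2 = complex.Re (l2_dot w w) by rewrite dot_rnorm.
have D : l2_dot (u + v) (u + v) =
    l2_dot u u + l2_dot v v + (l2_dot u v + (l2_dot u v)^*).
  exact: (dnormD (@l2_dot R X)).
have B : l2_dot (u - v) (u - v) =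
    l2_dot u u + l2_dot v v - (l2_dot u v + (l2_dot u v)^*).
  exact: (dnormB (@l2_dot R X)).
rewrite !E D B; case: (l2_dot u u) => a a'; case: (l2_dot v v) => b b'.
case: (_ + _^*) => c c' /=; lra.
Qed.

Lemma csum_single (f : X -> R[i]) x : (forall y, y != x -> f y = 0) ->
  csum f = f x.
Proof.
have single (a : X -> R) : (forall y, y != x -> a y = 0) -> rsum a = a x.
  have nn (b : X -> R) :
      (forall y, 0 <= b y) -> (forall y, y != x -> b y = 0) -> nnsum b = b x.
    move=> b0 h; rewrite /nnsum.
    have -> : (\esum_(y in [set: X]) (b y)%:E =
               \esum_(y in [set x]) (b y)%:E)%E.
      rewrite [RHS]esum_mkcond; apply: eq_esum => y _.
      by case: ifPn => // /negP; rewrite inE => /eqP yx; rewrite h.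
    by rewrite esum_set1// lee_fin.
  move=> h; rewrite /rsum !nn.
  - by rewrite -[in RHS](funrposBneg a).
  - by move=> y; exact: funrneg_ge0.
  - by move=> y yx; rewrite /funrneg h// oppr0 maxxx.
  - by move=> y; exact: funrpos_ge0.
  - by move=> y yx; rewrite /funrpos h// maxxx.
move=> h; rewrite /csum !single; first by case: (f x).
- by move=> y /h ->.
- by move=> y /h ->.
Qed.

Lemma dot_delta u x : l2_dot u (delta R x) = u x.
Proof.
rewrite /l2_dot (@csum_single _ x) => [|y /negbTE yx]; rewrite deltaE.
  by rewrite eqxx rmorph1 mulr1.
by rewrite yx rmorph0 mulr0.
Qed.

Lemma rnorm_delta x : rnorm (delta R x) = 1.
Proof.
have := dot_rnorm (delta R x); rewrite dot_delta deltaE eqxx => /esym.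
move=> /(@complexI R) /eqP; rewrite sqrf_eq1 => /orP[/eqP//|/eqP h].
by have := rnorm_ge0 (delta R x); rewrite h ler0N1.
Qed.

(* The value is 0 if f is not square summable. *)
Definition l2_of (f : X -> R[i]) : l2 R X := insubd (0 : l2 R X) f.

Lemma l2_ofE (f : X -> R[i]) x : f \in @square_summable R X -> l2_of f x = f x.
Proof. by move=> fs; rewrite /l2_of -[l2_fun _]/(val _) insubdK. Qed.

(** The diagonal projection 1_A. *)
Definition restr A u : l2 R X := l2_of (fun x => if x \in A then u x else 0).

Lemma restrE A u x : restr A u x = if x \in A then u x else 0.
Proof.
rewrite l2_ofE//; apply: (@in_l2 _ (rnorm u ^+ 2)); first exact: sqr_ge0.
move=> s us; apply: le_trans (sum_le_rnorm u us).
apply: ler_sum => y _; case: ifP => // _.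
by rewrite rnorm0 expr0n sqr_ge0.
Qed.

Lemma restr_linear A : linear (restr A).
Proof.
move=> c u v; apply: l2P => x; rewrite l2D l2Z !restrE l2D l2Z.
by case: ifP => // _; rewrite mulr0 addr0.
Qed.

Lemma restrB A u v : restr A (u - v) = restr A u - restr A v.
Proof.
by apply: l2P => x; rewrite l2B !restrE l2B; case: ifP; rewrite ?subr0.
Qed.

Lemma restrD A u v : restr A (u + v) = restr A u + restr A v.
Proof.
by apply: l2P => x; rewrite l2D !restrE l2D; case: ifP; rewrite ?addr0.
Qed.

Lemma restrZ A c u : restr A (c *: u) = c *: restr A u.
Proof.
by apply: l2P => x; rewrite l2Z !restrE l2Z; case: ifP; rewrite ?mulr0.
Qed.

Lemma restr0 A : restr A 0 = 0.
Proof. by apply: l2P => x; rewrite restrE if_same. Qed.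

Lemma restr_le A u : rnorm (restr A u) <= rnorm u.
Proof.
apply: rnorm_le => x; rewrite restrE; case: ifP => // _.
by rewrite rnorm0 rnorm_ge0.
Qed.

Lemma restr_mono A B u : A `<=` B -> rnorm (restr A u) <= rnorm (restr B u).
Proof.
move=> AB; apply: rnorm_le => x; rewrite !restrE.
case: ifPn => [|_]; last by rewrite rnorm0 rnorm_ge0.
by rewrite inE => /AB xB; rewrite mem_set.
Qed.

Lemma restrC A u : restr A u + restr (~` A) u = u.
Proof.
apply: l2P => x; rewrite l2D !restrE in_setC.
by case: (x \in A); rewrite ?addr0 ?add0r.
Qed.

Lemma restr_set1 x u : restr [set x] u = u x *: delta R x.
Proof.
apply: l2P => y; rewrite restrE l2Z deltaE.
have [->|yx] := eqVneq y x; first by rewrite mem_set// mulr1.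
by rewrite memNset ?mulr0// => /= /eqP; rewrite (negbTE yx).
Qed.

Lemma restr_seq (s : seq X) u : uniq s ->
  restr [set` s] u = \sum_(x <- s) u x *: delta R x.
Proof.
move=> us; apply: l2P => y; rewrite l2_sum restrE.
under eq_bigr do rewrite l2Z deltaE.
case: ifPn => [|/negP]; rewrite inE/= => ys.
  rewrite (bigD1_seq y)//= eqxx mulr1 big1 ?addr0// => i /negbTE.
  by rewrite eq_sym => ->; rewrite mulr0.
rewrite big1_seq// => i /= iS; case: eqP => [yi|_]; last by rewrite mulr0.
by move: ys; rewrite yi iS.
Qed.

Lemma l2_tail u (e : R) : 0 < e ->
  exists2 s : seq X, uniq s & rnorm (restr (~` [set` s]) u) <= e.
Proof.
move=> e0.
have [s us hs] : exists2 s : seq X, uniq s &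
    rnorm u ^+ 2 - e ^+ 2 < \sum_(x <- s) rnorm (u x) ^+ 2.
  apply: nnsum_lt_sum.
  - by move=> x; exact: sqr_ge0.
  - exact: summable_sqr.
  - by rewrite -rnorm_sqr gtrBl exprn_gt0.
exists s => //; apply: rnorm_le_sum; first exact: ltW.
move=> t ut; rewrite (bigID (fun x => x \in s))/= big1; last first.
  by move=> x xs; rewrite restrE in_setC mem_set// rnorm0 expr0n.
rewrite add0r (eq_bigr (fun x => rnorm (u x) ^+ 2)); last first.
  by move=> x xs; rewrite restrE in_setC memNset//; exact/negP.
rewrite -big_filter.
(* Only the part of [t] off [s] contributes. Appended to [s] it has total at most [rnorm u ^+ 2],
   and [s] already takes all but [e ^+ 2] of that. *)
have ust : uniq (s ++ [seq x <- t | x \notin s]).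
  rewrite cat_uniq us filter_uniq// andbT /=; apply/hasPn => x.
  by rewrite mem_filter => /andP[].
have := sum_le_rnorm u ust; rewrite big_cat/=; move: hs.
set a := \sum_(_ <- s) _; set b := \sum_(_ <- [seq x <- t | x \notin s]) _; lra.
Qed.

End L2Norm.
(** * Uniform Roe algebras of metric spaces *)

Section MetricCoarse.
Variables (R : realType) (X : metricType R).

(** By the triangle inequality, the relations of bounded distance already form a coarse structure
    containing the generators, so the smallest one is no larger. *)
Lemma metric_coarseP (A : set (X * X)) : metric_coarse X A <->
  exists2 r : R, 0 <= r & forall x y, A (x, y) -> mdist x y <= r.
Proof.
split=> [|[r r0 Ar]]; last first.
  move=> E [[_ E2 _ _ _] hE]; apply: (E2 [set xy | mdist xy.1 xy.2 <= r]).
    by move=> [x y] /Ar.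
  by apply: hE; exists r.
move=> /(_ [set B | exists2 r : R, 0 <= r &
  forall x y, B (x, y) -> mdist x y <= r]).
apply; split; last first.
  by move=> _ [r r0 <-]; exists r.
split.
- exists 0 => // x y; rewrite /diagonal/= => ->.
  by rewrite mdistxx.
- by move=> B C CB [r r0 Br]; exists r => // x y /CB /Br.
- move=> B [r r0 Br]; exists r => // x y /Br.
  by rewrite metric_sym.
- move=> B C [r r0 Br] [r' r'0 Cr]; exists (r + r'); first exact: addr_ge0.
  move=> x y [/Br h|/Cr h]; apply: le_trans h _; lra.
- move=> B C [r r0 Br] [r' r'0 Cr]; exists (r + r'); first exact: addr_ge0.
  move=> x y [z /= /Br h /Cr h'].
  by apply: le_trans (metric_triangle x z y) _; rewrite lerD.
Qed.

Lemma seq_ub (T : eqType) (f : T -> R) (s : seq T) :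
  exists2 r : R, 0 <= r & forall x, x \in s -> f x <= r.
Proof.
elim: s => [|y s [r r0 sr]]; first by exists 0.
exists (Num.max r (f y)); first by rewrite le_max r0.
move=> x; rewrite inE le_max => /orP[/eqP ->|/sr ->//].
by rewrite lexx orbT.
Qed.

Lemma seq_mdist_ub (s t : seq X) : exists2 r : R, 0 <= r &
  forall x y, x \in s -> y \in t -> mdist x y <= r.
Proof.
have [r r0 h] := seq_ub (fun xy : X * X => mdist xy.1 xy.2)
  [seq (x, y) | x <- s, y <- t].
exists r => // x y xs yt; apply: (h (x, y)).
by apply/allpairsP; exists (x, y).
Qed.

(** Balls are listed as duplicate-free sequences in order to be index sets of finite sums. *)
Lemma ulf_ball : uniformly_locally_finite (metric_coarse X) ->
  forall r : R, exists n : nat, forall x, exists2 s : seq X,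
    uniq s /\ (size s <= n)%N & forall y, (mdist x y <= r) <-> y \in s.
Proof.
move=> ulf r.
have [|n hn] := ulf [set xy | mdist xy.1 xy.2 <= r].
  apply/metric_coarseP; exists (Num.max r 0); first by rewrite le_max lexx orbT.
  by move=> x y /= h; rewrite le_max h.
exists n => x; have := hn x; set B := [set y | _] => Bn.
have finB : finite_set B by apply/finite_set_leP; exists n.
exists (finmap.enum_fset (fset_set B)).
  by rewrite finmap.fset_uniq geq_card_fset_set.
by move=> y; rewrite in_fset_set//; split=> [?|/set_mem//]; exact/mem_set.
Qed.

End MetricCoarse.

Section BoundedOperators.
Variables (R : realType) (V : normedModType R[i]).
Implicit Types (T S : V -> V) (u v : V).

Lemma bounded_operatorP T : bounded_operator T <->
  linear T /\ exists2 M : R, 0 <= M & forall u, rnorm (T u) <= M * rnorm u.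
Proof.
split=> [[lT [M hM]]|[lT [M M0 hM]]]; split=> //.
  exists (Num.max M 0) => [|u]; first by rewrite le_max lexx orbT.
  have := hM u; rewrite !rnormE -rmorphM lecR => h.
  by apply: le_trans h _; rewrite ler_wpM2r ?rnorm_ge0// le_max lexx.
by exists M => u; rewrite !rnormE -rmorphM lecR.
Qed.

Lemma linear_fun0 (W : lmodType R[i]) (T : V -> W) : linear T -> T 0 = 0.
Proof.
by move=> lT; have := lT (-1) 0 0; rewrite scaler0 addr0 scaleN1r addNr.
Qed.

Lemma linear_funD (W : lmodType R[i]) (T : V -> W) u v :
  linear T -> T (u + v) = T u + T v.
Proof. by move=> lT; have := lT 1 u v; rewrite !scale1r. Qed.

Lemma linear_funZ (W : lmodType R[i]) (T : V -> W) c u :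
  linear T -> T (c *: u) = c *: T u.
Proof.
by move=> lT; have := lT c u 0; rewrite addr0 (linear_fun0 lT) addr0.
Qed.

Lemma linear_funB (W : lmodType R[i]) (T : V -> W) u v :
  linear T -> T (u - v) = T u - T v.
Proof.
by move=> lT; have := lT (-1) v u; rewrite !scaleN1r ![- _ + _]addrC.
Qed.

Lemma linear_fun_sum (W : lmodType R[i]) (T : V -> W) I (s : seq I)
    (F : I -> V) : linear T -> T (\sum_(i <- s) F i) = \sum_(i <- s) T (F i).
Proof.
move=> lT; elim/big_rec2: _ => [|i a b _ <-]; first exact: linear_fun0.
by rewrite linear_funD.
Qed.

Lemma bounded_operatorB T S :
  bounded_operator T -> bounded_operator S -> bounded_operator (T \- S).
Proof.
move=> /bounded_operatorP[lT [M M0 hM]] /bounded_operatorP[lS [N N0 hN]].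
apply/bounded_operatorP; split.
  by move=> c u v; rewrite /= lT lS scalerBr opprD addrACA.
exists (M + N) => [|u]; first exact: addr_ge0.
by rewrite mulrDl; apply: le_trans (rnormB _ _) _; rewrite lerD.
Qed.

Lemma rnorm_le_opnorm T u : bounded_operator T -> rnorm u <= 1 ->
  rnorm (T u) <= opnorm T.
Proof.
move=> /bounded_operatorP[lT [M M0 hM]] u1; apply: ub_le_sup.
  exists M => _ [v v1 <-]; apply: le_trans (hM v) _.
  by rewrite ler_piMr// -lecR -rnormE.
by exists u => //=; rewrite rnormE lecR.
Qed.

Lemma opnorm_le T (m : R) : (forall u, rnorm u <= 1 -> rnorm (T u) <= m) ->
  opnorm T <= m.
Proof.
move=> Tm; apply: ge_sup.
  by exists (rnorm (T 0)), 0 => //=; rewrite normr0.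
by move=> _ [u u1 <-]; apply: Tm; rewrite -lecR -rnormE.
Qed.

End BoundedOperators.
(** The arithmetic of [rank1_roe]: [a] and [b] are the norms of the tails of two vectors of norms
    [w] and [v], [w'] is the norm of a truncation of the first, and [u] that of a vector of the unit
    ball. The [+ 1] keeps the denominator of [d] positive when both vectors vanish. *)
Lemma le_half_bound (R : realFieldType) (a b d e u v w w' : R) :
  0 <= a -> 0 <= b -> 0 <= v -> 0 <= w' -> 0 <= u -> 0 <= d ->
  a <= d -> b <= d -> w' <= w -> u <= 1 ->
  d * (2 * (w + v + 1)) = e -> a * v * u + w' * b * u <= e / 2.
Proof.
move=> a0 b0 v0 w0 u0 d0 ad bd ww u1 <-.
apply: (@le_trans _ _ (d * v + w * d)); last by lra.
apply: lerD.
  by apply: le_trans (ler_piMr _ u1) _; rewrite ?mulr_ge0// ler_wpM2r.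
by apply: le_trans (ler_piMr _ u1) _; rewrite ?mulr_ge0// ler_pM.
Qed.

Section RoeMembers.
Variables (R : realType) (X : metricType R).
Implicit Types (T S : l2 R X -> l2 R X) (u v w : l2 R X) (x y : X) (A : set X).

Notation roe := (uniform_roe (metric_coarse X)).

Lemma suppE T x y : supp T (x, y) <-> T (delta R x) y != 0.
Proof. by rewrite /supp /= dot_delta. Qed.

Lemma supp_coarse T (r : R) : 0 <= r ->
  (forall x y, T (delta R x) y != 0 -> mdist x y <= r) ->
  metric_coarse X (supp T).
Proof.
by move=> r0 h; apply/metric_coarseP; exists r => // x y /suppE /h.
Qed.

Lemma finite_propagation_roe T : bounded_operator T ->
  metric_coarse X (supp T) -> roe T.
Proof.
move=> bT sT; split=> // e e0; exists T; split=> //.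
apply: le_lt_trans e0; apply: opnorm_le => u _.
by rewrite /= subrr rnorm0.
Qed.

Lemma roe_approx T (e : R) : roe T -> 0 < e -> exists2 S, bounded_operator S &
  exists2 r : R, 0 <= r &
    (forall x y, S (delta R x) y != 0 -> mdist x y <= r) /\
    forall u, rnorm u <= 1 -> rnorm (T u - S u) <= e.
Proof.
move=> [bT aT] /aT [S [bS /metric_coarseP [r r0 hr] Se]]; exists S => //.
exists r => //; split; first by move=> x y /suppE /hr.
move=> u u1; apply: le_trans (ltW Se).
exact: (rnorm_le_opnorm (bounded_operatorB bT bS)).
Qed.

Lemma restr_bounded A : bounded_operator (@restr R X A).
Proof.
apply/bounded_operatorP; split; first exact: restr_linear.
by exists 1 => // u; rewrite mul1r restr_le.
Qed.

Lemma restr_roe A : roe (@restr R X A).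
Proof.
apply: finite_propagation_roe (restr_bounded A) _.
apply: (@supp_coarse _ 0) => // x y; rewrite restrE deltaE.
case: ifP => _; last by rewrite eqxx.
by have [->|_] := eqVneq y x; rewrite ?mdistxx// eqxx.
Qed.

(** The operator |w><v|. *)
Definition rank1 w v : l2 R X -> l2 R X := fun u => l2_dot u v *: w.

Lemma rank1_linear w v : linear (rank1 w v).
Proof.
by move=> c u u'; rewrite /rank1 l2_dotDl l2_dotZl scalerDl scalerA.
Qed.

Lemma rank1_bound w v u : rnorm (rank1 w v u) <= rnorm w * rnorm v * rnorm u.
Proof.
rewrite /rank1 rnormZ mulrC -mulrA ler_wpM2l ?rnorm_ge0//.
by rewrite [leRHS]mulrC rnorm_dot.
Qed.

Lemma rank1_bounded w v : bounded_operator (rank1 w v).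
Proof.
apply/bounded_operatorP; split; first exact: rank1_linear.
exists (rnorm w * rnorm v); last exact: rank1_bound.
by rewrite mulr_ge0 ?rnorm_ge0.
Qed.

(** Truncating both vectors to finite sets changes the operator little in norm and makes its support
    finite, hence of bounded distance. *)
Lemma rank1_roe w v : roe (rank1 w v).
Proof.
split=> [|e e0]; first exact: rank1_bounded.
have d0 : 0 < e / (2 * (rnorm w + rnorm v + 1)).
  by rewrite divr_gt0// mulr_gt0// ltr_wpDl// addr_ge0 ?rnorm_ge0.
set d := _ / _ in d0; have [s us hs] := l2_tail w d0.
have [t ut ht] := l2_tail v d0.
exists (rank1 (restr [set` s] w) (restr [set` t] v)); split.
- exact: rank1_bounded.
- have [r r0 hr] := seq_mdist_ub t s.
  apply: (supp_coarse r0) => x y; rewrite /rank1 l2Z mulf_eq0 negb_or.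
  move=> /andP[h1 h2]; apply: hr.
    apply: contraNT h1 => xt.
    have -> : l2_dot (delta R x) (restr [set` t] v) =
              (l2_dot (restr [set` t] v) (delta R x))^*.
      exact: l2_dotC.
    by rewrite dot_delta restrE memNset ?rmorph0//; exact/negP.
  by apply: contraNT h2 => ys; rewrite restrE memNset//; exact/negP.
apply: (@le_lt_trans _ _ (e / 2)).
  2: by rewrite ltr_pdivrMr// ltr_pMr// ltr1n.
apply: opnorm_le => u u1.
(* One vector is truncated at a time, so that each summand contains exactly one small tail. *)
have -> : (rank1 w v \- rank1 (restr [set` s] w) (restr [set` t] v)) u =
    rank1 (restr (~` [set` s]) w) v u
    + rank1 (restr [set` s] w) (restr (~` [set` t]) v) u.
  have Ev : l2_dot u v = l2_dot u (restr [set` t] v) +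
      l2_dot u (restr (~` [set` t]) v) by rewrite -l2_dotDr restrC.
  rewrite /rank1 /= Ev -{1}(restrC [set` s] w) scalerDr addrAC -scalerBl.
  by rewrite addrC [X in X - _]addrC addrK.
apply: le_trans (rnormD _ _) _.
apply: le_trans (lerD (rank1_bound _ _ _) (rank1_bound _ _ _)) _.
have dE : d * (2 * (rnorm w + rnorm v + 1)) = e.
  by rewrite /d mulfVK// lt0r_neq0// mulr_gt0// ltr_wpDl// addr_ge0 ?rnorm_ge0.
exact: (le_half_bound (rnorm_ge0 _) (rnorm_ge0 _) (rnorm_ge0 _) (rnorm_ge0 _)
  (rnorm_ge0 _) (ltW d0) hs ht (restr_le _ _) u1 dE).
Qed.

Lemma rank1_adjoint w v : is_adjoint (@l2_dot R X) (rank1 w v) (rank1 v w).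
Proof.
move=> u u'; change (l2_dot (rank1 w v u) u' = l2_dot u (rank1 v w u')).
by rewrite /rank1 l2_dotZl l2_dotZr -l2_dotC mulrC.
Qed.

Lemma rank1_comp w v w' v' :
  rank1 w v \o rank1 w' v' = l2_dot w' v \*: rank1 w v'.
Proof.
apply/funext => u; by rewrite /rank1 /= l2_dotZl scalerA mulrC.
Qed.

End RoeMembers.
(** * Isomorphisms are spatially implemented *)

Section Spatial.
Variable R : realType.

Notation roe X := (uniform_roe (metric_coarse X)).

Record spatial (X Y : metricType R) (U : l2 R X -> l2 R Y)
    (V : l2 R Y -> l2 R X) : Prop := Spatial {
  spatial_linearU : linear U;
  spatial_linearV : linear V;
  spatial_K : cancel U V;
  spatial_VK : cancel V U;
  spatial_dot : forall u w, l2_dot (U u) w = l2_dot u (V w);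
  spatial_roeU : forall T, roe X T -> roe Y (U \o T \o V);
  spatial_roeV : forall S, roe Y S -> roe X (V \o S \o U) }.

Lemma spatial_sym (X Y : metricType R) (U : l2 R X -> l2 R Y) V :
  spatial U V -> spatial V U.
Proof.
move=> [lU lV UK VK dUV rU rV]; split=> // w u.
by rewrite l2_dotC -dUV -l2_dotC.
Qed.

Lemma spatial_rnorm (X Y : metricType R) (U : l2 R X -> l2 R Y) V u :
  spatial U V -> rnorm (U u) = rnorm u.
Proof.
move=> sUV; have := spatial_dot sUV u (U u).
rewrite (spatial_K sUV) !dot_rnorm => /(@complexI R)/eqP.
by rewrite eqrXn2 ?rnorm_ge0// => /eqP.
Qed.

Section FromIsomorphism.
Variables (X Y : metricType R) (phi : (l2 R X -> l2 R X) -> (l2 R Y -> l2 R Y)).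
Hypothesis phi_iso :
  star_isomorphism (@l2_dot R X) (@l2_dot R Y) (roe X) (roe Y) phi.

Let phi_roe T : roe X T -> roe Y (phi T).
Proof. by case: phi_iso => -[h _ _] _ _ _ _ /h. Qed.

Let phi_linear T : roe X T -> linear (phi T).
Proof. by move=> /phi_roe [[]]. Qed.

Let phi_surj S : roe Y S -> exists2 T, roe X T & phi T = S.
Proof. by case: phi_iso => -[_ _ h] _ _ _ _ /h [T AT <-]; exists T. Qed.

Let phi_inj T S : roe X T -> roe X S -> phi T = phi S -> T = S.
Proof.
by case: phi_iso => -[_ h _] _ _ _ _ AT AS; apply: h; exact/mem_set.
Qed.

Let phiD T S : roe X T -> roe X S -> phi (T \+ S) = phi T \+ phi S.
Proof. by case: phi_iso => _ h _ _ _; exact: h. Qed.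

Let phiZ c T : roe X T -> phi (c \*: T) = c \*: phi T.
Proof. by case: phi_iso => _ _ h _ _; exact: h. Qed.

Let phiM T S : roe X T -> roe X S -> phi (T \o S) = phi T \o phi S.
Proof. by case: phi_iso => _ _ _ h _; exact: h. Qed.

Let phi_adj w v u u' :
  l2_dot (phi (rank1 w v) u) u' = l2_dot u (phi (rank1 v w) u').
Proof.
case: phi_iso => _ _ _ _ h.
exact: (h _ _ (rank1_roe w v) (rank1_roe v w) (rank1_adjoint w v) u u').
Qed.

Let phi_rank10 v u : phi (rank1 0 v) u = 0.
Proof.
have -> : rank1 0 v = 0 \*: rank1 (0 : l2 R X) v.
  by apply/funext => w; rewrite /= /rank1 !scaler0.
by rewrite (phiZ _ (rank1_roe 0 v)) /= scale0r.
Qed.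

(* U u is the image under phi of the rank one operator |u><x0|, applied to a unit
   vector xi in the range of the projection phi |x0><x0|. It is onto since, if
   phi T = |w><xi|, then U (T x0) = w. *)
Let spatial_nonempty (x0 : X) : exists U V, @spatial X Y U V.
Proof.
pose d0 := delta R x0; pose e := rank1 d0 d0.
have re : roe X e by exact: rank1_roe.
have d1 : l2_dot d0 d0 = 1 by rewrite dot_delta deltaE eqxx.
have ee : e \o e = e.
  by rewrite rank1_comp d1; apply/funext => u /=; rewrite scale1r.
(* Injectivity: [e] fixes the nonzero vector [d0], so it is not the zero operator, and neither is
   its image. *)
have [v pv] : exists v, phi e v != 0.
  apply: contrapT => h.
  have : e = rank1 0 d0.
    apply: (phi_inj re (rank1_roe 0 d0)).
    apply/funext => u; rewrite phi_rank10; apply/eqP/negPn/negP => pu.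
    by apply: h; exists u.
  move=> /(congr1 (fun f : l2 R X -> l2 R X => f d0 x0)).
  rewrite /e /rank1 d1 !scale1r l20 deltaE eqxx.
  by move/eqP; rewrite oner_eq0.
have pp u : phi e (phi e u) = phi e u.
  by rewrite -[LHS]/((phi e \o phi e) u) -(phiM re re) ee.
pose xi := (rnorm (phi e v))^-1%:C%C *: phi e v.
have pxi : phi e xi = xi.
  by rewrite /xi (linear_funZ _ _ (phi_linear re)) pp.
have xi1 : l2_dot xi xi = 1.
  rewrite dot_rnorm /xi rnormZ; set a := rnorm _; set b := rnorm _.
  have -> : a = b^-1.
    by rewrite /a /rnorm ger0_norm// ler0c invr_ge0 rnorm_ge0.
  by rewrite mulVf ?expr1n// rnorm_eq0.
pose U u := phi (rank1 u d0) xi.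
have lU : linear U.
  move=> c u u'; rewrite /U.
  have -> : rank1 (c *: u + u') d0 = (c \*: rank1 u d0) \+ rank1 u' d0.
    by apply/funext => w; rewrite /rank1 /= scalerDr scalerA mulrC -scalerA.
  have rZ : roe X (c \*: rank1 u d0).
    have -> : c \*: rank1 u d0 = rank1 (c *: u) d0.
      by apply/funext => w; rewrite /rank1 /= scalerA mulrC -scalerA.
    exact: rank1_roe.
  by rewrite (phiD rZ (rank1_roe u' d0)) (phiZ _ (rank1_roe u d0)).
(* The product |x0><u| |u'><x0| is the scalar [l2_dot u' u] times [e], and [phi e] fixes the unit
   vector [xi]. *)
have dU u u' : l2_dot (U u) (U u') = l2_dot u u'.
  rewrite /U phi_adj.
  rewrite -[phi _ (phi _ _)]/((phi (rank1 d0 u) \o phi (rank1 u' d0)) xi).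
  rewrite -(phiM (rank1_roe d0 u) (rank1_roe u' d0)) rank1_comp (phiZ _ re) /=.
  by rewrite -/e pxi l2_dotZr xi1 mulr1 -l2_dotC.
(* This rests on T |u><x0| = |T u><x0|. *)
have UT T u : roe X T -> U (T u) = phi T (U u).
  move=> rT; rewrite /U -[RHS]/((phi T \o phi (rank1 u d0)) xi).
  rewrite -(phiM rT (rank1_roe u d0)).
  congr (phi _ _); apply/funext => w; rewrite /rank1 /=.
  by rewrite (linear_funZ _ _ rT.1.1).
have Usurj w : exists u, U u = w.
  have [T rT pT] := phi_surj (rank1_roe w xi).
  exists (T d0); rewrite UT// pT /rank1.
  have -> : U d0 = xi by rewrite /U -/e pxi.
  by rewrite xi1 scale1r.
have [V VK] := choice Usurj.
have Uinj : injective U.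
  move=> u u' uu'; apply/eqP; rewrite -subr_eq0 -rnorm_eq0 -sqrf_eq0.
  have := dU (u - u') (u - u').
  rewrite (linear_funB _ _ lU) uu' subrr !dot_rnorm rnorm0.
  by move=> /(@complexI R) <-; rewrite expr0n.
have UK : cancel U V by move=> u; apply: Uinj; rewrite VK.
exists U, V; split.
- exact: lU.
- by move=> c w w'; apply: Uinj; rewrite lU !VK.
- exact: UK.
- exact: VK.
- by move=> u w; rewrite -{1}(VK w) dU.
- move=> T rT; have -> : U \o T \o V = phi T; last exact: phi_roe.
  by apply/funext => w /=; rewrite UT// VK.
- move=> S /phi_surj [T rT <-]; have -> : V \o phi T \o U = T; last exact: rT.
  by apply/funext => u /=; rewrite -UT// UK.
Qed.

Lemma spatial_exists : exists U V, @spatial X Y U V.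
Proof.
have [[x0 _]|X0] := pselect (exists x : X, True); first exact: spatial_nonempty.
have uX (u u' : l2 R X) : u = u' by apply: l2P => x; case: X0; exists x.
(* With [X] empty the only operator on its side is zero, so every element of the other algebra
   vanishes. A point [y] would give the nonzero operator |y><y|. *)
have Y0 (y : Y) : False.
  have [T _ pT] := phi_surj (rank1_roe (delta R y) (delta R y)).
  have := phi_rank10 0 (delta R y).
  have -> : rank1 0 0 = T by apply/funext.
  rewrite pT /rank1 dot_delta deltaE eqxx scale1r.
  move=> /(congr1 (fun u => l2_fun u y)).
  by rewrite deltaE eqxx l20 => /eqP; rewrite oner_eq0.
have uY (u u' : l2 R Y) : u = u' by apply: l2P.
exists (fun=> 0), (fun=> 0); split.
- by move=> c u u'; rewrite scaler0 addr0.
- by move=> c u u'; rewrite scaler0 addr0.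
- by move=> u; exact: uX.
- by move=> u; exact: uY.
- by move=> u w; rewrite (uY w 0) (uX u 0) !linear0r.
- move=> T _; rewrite (_ : _ \o _ = rank1 0 0); first exact: rank1_roe.
  by apply/funext.
- move=> T _; rewrite (_ : _ \o _ = rank1 0 0); first exact: rank1_roe.
  by apply/funext.
Qed.

End FromIsomorphism.
End Spatial.
(** * Uniform tightness *)

Section Tightness.
Variable R : realType.

Notation roe X := (uniform_roe (metric_coarse X)).

Definition far (X : metricType R) (r : R) (x : X) : set X :=
  [set y | r < mdist x y].

Lemma restr_far_le (X : metricType R) (r r' : R) (x : X) (u : l2 R X) :
  r <= r' -> rnorm (restr (far r' x) u) <= rnorm (restr (far r x) u).
Proof. by move=> rr'; apply: restr_mono => y; apply: le_lt_trans. Qed.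

(** An approximant of propagation [r] has no mass beyond [r] at any point, so only the norm error
    remains there. *)
Lemma roe_tight (X : metricType R) T (e : R) : roe X T -> 0 < e ->
  exists2 r : R, 0 <= r &
    forall x, rnorm (restr (far r x) (T (delta R x))) <= e.
Proof.
move=> rT e0; have [S _ [r r0 [Sr TS]]] := roe_approx rT e0.
exists r => // x.
rewrite (_ : restr _ _ = restr (far r x) (T (delta R x) - S (delta R x))).
  by apply: le_trans (restr_le _ _) _; apply: TS; rewrite rnorm_delta.
rewrite restrB (_ : restr _ (S _) = 0) ?subr0//.
apply: l2P => y; rewrite restrE; case: ifPn => // /set_mem xy.
by apply/eqP; apply: contraTT xy => /Sr; rewrite /far/= -leNgt.
Qed.

Lemma restr_split (X : choiceType) (A B : set X) (u : l2 R X) :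
  restr A u = restr (A `&` B) u + restr (A `\` B) u.
Proof.
apply: l2P => x; rewrite l2D !restrE in_setI in_setD.
by case: (x \in A); case: (x \in B); rewrite /= ?addr0 ?add0r.
Qed.

Section Uniform.
Variables (X Y : metricType R) (U : l2 R X -> l2 R Y) (V : l2 R Y -> l2 R X).
Hypothesis sUV : spatial U V.

Let lV := spatial_linearV sUV.

Let tl (r : R) (A : set Y) (x : X) : R :=
  rnorm (restr (far r x) (V (restr A (U (delta R x))))).

Let tl_tight A (e : R) :
  0 < e -> exists2 r : R, 0 <= r & forall x, tl r A x <= e.
Proof. exact: (roe_tight (spatial_roeV sUV (restr_roe A))). Qed.

Let tl_le (r r' : R) A x : r <= r' -> tl r' A x <= tl r A x.
Proof. exact: restr_far_le. Qed.

Let tl_set0 r x : tl r set0 x = 0.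
Proof.
rewrite /tl (_ : restr set0 _ = 0).
  by rewrite (linear_fun0 lV) restr0 rnorm0.
by apply: l2P => y; rewrite restrE in_set0.
Qed.

Let tl_split r A B x : tl r A x <= tl r (A `&` B) x + tl r (A `\` B) x.
Proof.
by rewrite {1}/tl (restr_split A B) (linear_funD _ _ lV) restrD rnormD.
Qed.

(** The radius depends on [s] but not on [A]. Adding a point [y] to [s] costs only the tightness of
    the single set [[set y]], since [A] meets it in all or nothing. *)
Let tl_finite (s : seq Y) (e : R) : 0 < e -> exists2 r : R, 0 <= r &
  forall A x, A `<=` [set` s] -> tl r A x <= e.
Proof.
elim: s e => [|y s IH] e e0.
  exists 0 => // A x A0; rewrite (_ : A = set0) ?tl_set0 ?ltW//.
  by rewrite -subset0 => z /A0.
have e2 : 0 < e / 2 by rewrite divr_gt0.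
have [r r0 hr] := IH _ e2; have [r' r'0 hr'] := tl_tight [set y] e2.
exists (Num.max r r') => [|A x As]; first by rewrite le_max r0.
rewrite [e]splitr; apply: le_trans (tl_split _ A [set y] x) _; apply: lerD.
  apply: le_trans (tl_le _ _ (_ : r' <= _)) _.
    by rewrite le_max lexx orbT.
  have [Ay|nAy] := pselect (A y).
    rewrite (_ : A `&` _ = [set y]) //; apply/seteqP; split=> z; first by case.
    by move=> ->.
  rewrite (_ : A `&` _ = set0) ?tl_set0 ?ltW//.
  by rewrite -subset0 => z [Az zy]; apply: nAy; rewrite -zy.
apply: le_trans (tl_le _ _ (_ : r <= _)) _; first by rewrite le_max lexx.
apply: hr => z [/As]; rewrite /= inE => /orP[/eqP ->|//].
by move=> /(_ erefl).
Qed.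

(* The gliding hump: from a counterexample, build a set all of whose finite
   approximations stay bad, against the tightness of that single set. *)
Lemma uniform_tight (e : R) : 0 < e -> exists2 r : R, 0 <= r & forall A x,
  rnorm (restr (far r x) (V (restr A (U (delta R x))))) <= e.
Proof.
move=> e0; apply: contrapT => bad.
have {}bad (r : R) : 0 <= r -> exists A x, e < tl r A x.
  move=> r0; apply: contrapT => h; apply: bad; exists r => // A x.
  by rewrite leNgt; apply/negP => ?; apply: h; exists A, x.
(* A pair consists of the finitely many points whose membership is settled and of a set recording
   the decisions. The new decisions keep the old ones and force mass beyond radius [p.2], whatever
   is decided elsewhere. *)
have step (p : (seq Y * set Y) * nat) : exists q : seq Y * set Y,
    [/\ {subset p.1.1 <= q.1}, (forall y, y \in p.1.1 -> q.2 y <-> p.1.2 y) &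
     exists x, forall A : set Y, (forall y, y \in q.1 -> A y <-> q.2 y) ->
       e / 4 < tl p.2%:R A x].
  case: p => -[G A] n /=.
  have e4 : 0 < e / 4 by rewrite divr_gt0.
  have e8 : 0 < e / 8 by rewrite divr_gt0.
  have [rG rG0 hG] := tl_finite G e4.
  (* Beyond [rG] the points of [G] contribute at most [e / 4], whichever of them are in the set.
     Thus the bad set [A1] may be altered on [G] to respect earlier decisions. *)
  have [|A1 [x hx]] := bad (Num.max n%:R rG); first by rewrite le_max rG0 orbT.
  set r := Num.max _ _ in hx.
  have [G1 _ hG1] := l2_tail (U (delta R x)) e8.
  exists (G ++ G1, (A `&` [set` G]) `|` (A1 `\` [set` G])); split=> /=.
  - by move=> y yG; rewrite mem_cat yG.
  - by move=> y yG; split=> [[[]//|[]]|]; [move=> _ /(_ yG)|left].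
  exists x => B hB.
  apply: (@lt_le_trans _ _ (tl r B x)).
    2: by apply: tl_le; rewrite le_max lexx.
  have tG C : tl r (C `&` [set` G]) x <= e / 4.
    apply: le_trans (tl_le _ _ (_ : rG <= r)) _.
      by rewrite le_max lexx orbT.
    by apply: hG => y [].
  have h1 := tG A1; have h2 := tG B.
  have h3 := tl_split r A1 [set` G] x.
  have h4 : tl r (B `\` [set` G]) x <= tl r B x + tl r (B `&` [set` G]) x.
    pose w C := restr (far r x) (V (restr C (U (delta R x)))).
    have wB : w B = w (B `&` [set` G]) + w (B `\` [set` G]).
      by rewrite /w -restrD -(linear_funD _ _ lV) -restr_split.
    have -> : tl r (B `\` [set` G]) x = rnorm (w B - w (B `&` [set` G])).
      by rewrite wB [X in X - _]addrC addrK.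
    exact: rnormB.
  (* Off [G] the two sets can differ only outside [G1], where [U delta_x] has norm at most [e / 8],
     and [V] preserves norms. *)
  have h5 : tl r (A1 `\` [set` G]) x <= tl r (B `\` [set` G]) x + e / 8.
    set u := U (delta R x) in hG1; pose a := restr (A1 `\` [set` G]) u.
    pose b := restr (B `\` [set` G]) u.
    rewrite -[X in X <= _]/(rnorm (restr (far r x) (V a))).
    rewrite -[X in _ <= X + _]/(rnorm (restr (far r x) (V b))).
    rewrite -(subrK (V b) (V a)) addrC restrD.
    apply: le_trans (rnormD _ _) _; rewrite lerD2l.
    apply: le_trans (restr_le _ _) _; rewrite -(linear_funB _ _ lV).
    rewrite (spatial_rnorm _ (spatial_sym sUV)); apply: le_trans hG1.
    apply: rnorm_le => y; rewrite l2B !restrE !in_setD in_setC.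
    have [yG|yG] := boolP (y \in [set` G]).
      by rewrite !andbF subrr rnorm0 rnorm_ge0.
    rewrite !andbT; have [yG1|yG1] := boolP (y \in [set` G1]); last first.
      by case: (y \in A1); case: (y \in B);
        rewrite ?subrr ?subr0 ?sub0r ?rnormN ?rnorm0 ?rnorm_ge0.
    have {}hB : B y <-> A1 y.
      rewrite hB ?mem_cat ?[y \in G1](set_mem yG1) ?orbT//.
      move/negP : yG; rewrite inE/= => yG.
      by split=> [[[]//|[]//]|?]; right.
    rewrite (_ : (y \in B) = (y \in A1)) ?subrr//.
    by apply/idP/idP; rewrite !inE => /hB.
  (* What is left is at least [e - e / 4 - e / 8 - e / 4], that is [3 * e / 8], which exceeds
     [e / 4]. *)
  move: hx h1 h2 h3 h4 h5; clear -e0.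
  move: (tl r A1 x) (tl r B x) (tl r (A1 `\` _) x) (tl r (B `\` _) x)
    (tl r (A1 `&` _) x) (tl r (B `&` _) x) => *; lra.
have [F hF] := choice step.
pose st := fix st n := if n is m.+1 then F (st m, m) else ([::], set0).
have Gmono n m : (n <= m)%N -> {subset (st n).1 <= (st m).1}.
  move=> /subnK <-; elim: (m - n)%N => // k IH y /IH.
  by have [h _ _] := hF (st (k + n)%N, (k + n)%N); exact: h.
have Amono n m y : (n <= m)%N -> y \in (st n).1 -> (st m).2 y <-> (st n).2 y.
  move=> /subnK <- yn; elim: (m - n)%N => // k IH.
  have [_ h _] := hF (st (k + n)%N, (k + n)%N).
  rewrite -IH; apply: h; apply: Gmono yn; exact: leq_addl.
(* The limit set agrees with every stage on the points settled there, hence inherits all the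
   humps. *)
pose A y := exists2 n, y \in (st n).1 & (st n).2 y.
have Ast n y : y \in (st n).1 -> A y <-> (st n).2 y.
  move=> yn; split=> [[m ym my]|]; last by exists n.
  have [nm|mn] := leqP n m; first by apply/(Amono _ _ _ nm yn).
  by apply/(Amono _ _ _ (ltnW mn) ym).
have e4 : 0 < e / 4 by rewrite divr_gt0.
have [r r0 hr] := tl_tight A e4.
(* The radius of this step is an integer above [r]. The step with index [k] produces stage [k.+1],
   whence the comparison with stage [.+2]. *)
have [_ _ [x hx]] := hF (st (Num.truncn r).+1, (Num.truncn r).+1).
have := hx A (Ast (Num.truncn r).+2); apply/negP; rewrite -leNgt.
apply: le_trans (hr x); apply: tl_le; apply: ltW; exact: truncnS_gt.
Qed.

End Uniform.
End Tightness.
(** * Rigidity *)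

Section Peak.
Variable R : realType.

(** By the parallelogram identity the squared norms of [S + v] and [S - v] average to the sum of the
    squared norms, so the smaller of the two is at most that sum. Signs are thus chosen one at a
    time. *)
Lemma sign_choice (X : choiceType) (T : eqType) (s : seq T) (v : T -> l2 R X) :
  uniq s -> exists b : T -> bool,
    rnorm (\sum_(y <- s) if b y then v y else - v y) ^+ 2
      <= \sum_(y <- s) rnorm (v y) ^+ 2.
Proof.
elim: s => [_|y s IH /= /andP[ys us]].
  by exists (fun=> true); rewrite !big_nil rnorm0 expr0n.
have [b hb] := IH us; set S := \sum_(z <- s) _ in hb.
have hS c :
    \sum_(z <- s) (if (if z == y then c else b z) then v z else - v z) = S.
  by apply: eq_big_seq => z zs; case: eqP => // zy; rewrite -zy zs in ys.
have := parallelogram (v y) S; rewrite big_cons.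
have [h|h] := leP (rnorm (v y + S)) (rnorm (v y - S)) => e.
- exists (fun z => if z == y then true else b z).
  rewrite big_cons eqxx hS; have : rnorm (v y + S) ^+ 2 <= rnorm (v y - S) ^+ 2.
    by rewrite ler_sqr ?nnegrE ?rnorm_ge0.
  move: e hb.
  by move: (rnorm _ ^+ 2) (rnorm _ ^+ 2) (rnorm _ ^+ 2) (rnorm _ ^+ 2) => *;
    lra.
- exists (fun z => if z == y then false else b z).
  rewrite big_cons eqxx hS addrC -(rnormN (S - _)) opprB.
  have : rnorm (v y - S) ^+ 2 <= rnorm (v y + S) ^+ 2.
    by rewrite ler_sqr ?nnegrE ?rnorm_ge0// ltW.
  move: e hb.
  by move: (rnorm _ ^+ 2) (rnorm _ ^+ 2) (rnorm _ ^+ 2) (rnorm _ ^+ 2) => *;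
    lra.
Qed.

Lemma restr_seq_sqr (X : choiceType) (s : seq X) (u : l2 R X) : uniq s ->
  rnorm (restr [set` s] u) ^+ 2 <= \sum_(x <- s) rnorm (u x) ^+ 2.
Proof.
move=> us; apply: rnorm_sqr_le => [|t ut].
  by apply: sumr_ge0 => x _; exact: sqr_ge0.
rewrite (bigID (fun x => x \in s))/= [X in _ + X]big1 ?addr0; last first.
  by move=> x xs; rewrite restrE memNset ?rnorm0 ?expr0n//; exact/negP.
rewrite (eq_bigr (fun x => rnorm (u x) ^+ 2)); last first.
  by move=> x xs; rewrite restrE mem_set.
rewrite -big_filter (perm_big [seq x <- s | x \in t]).
  rewrite big_filter big_mkcond/=; apply: ler_sum => x _.
  by case: ifP => // _; exact: sqr_ge0.
apply: uniq_perm; rewrite ?filter_uniq// => x.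
by rewrite !mem_filter andbC.
Qed.

Variables (X Y : metricType R) (U : l2 R X -> l2 R Y) (V : l2 R Y -> l2 R X).
Hypothesis sUV : spatial U V.

Let lU := spatial_linearU sUV.
Let lV := spatial_linearV sUV.

(** [V] is the adjoint of [U], so their matrices are conjugate transposes. *)
Lemma spatial_coord x y : rnorm (V (delta R y) x) = rnorm (U (delta R x) y).
Proof.
rewrite -(dot_delta (U _)) (spatial_dot sUV) l2_dotC dot_delta.
exact/esym/rnorm_conj.
Qed.

(* If all coordinates of xi = U delta_x were small, then, with B the r-ball at x,
   the vectors restr B (V (xi y delta_y)) would have a small sum of squared norms,
   so a choice of signs D would make V (D xi) small on B. It is small off B by
   uniform tightness, yet its norm is that of xi. *)
Lemma spatial_peak : uniformly_locally_finite (metric_coarse X) ->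
  exists2 d : R, 0 < d & forall x, exists y, d <= rnorm (U (delta R x) y).
Proof.
have quarter : (1 / 8 + 1 / 8 : R) <= 1 / 4 by lra.
have half : (1 / 4 + 1 / 4 : R) <= 1 / 2 by lra.
have contra : (1 : R) <= 1 / 2 + 1 / 4 -> False by lra.
move=> ulf.
have [|r r0 hr] := @uniform_tight _ _ _ _ _ sUV (1 / 8).
  by rewrite divr_gt0.
have [N hN] := ulf_ball ulf r.
have N0 : (0 : R) <= N%:R by [].
(* Chosen so that [d ^+ 2 * N%:R] is at most [(1 / 4) ^+ 2]. *)
exists (4 * (N%:R + 1))^-1 => [|x].
  by rewrite invr_gt0 mulr_gt0// ltr_wpDl.
set d := _^-1; apply: contrapT => peak.
have {}peak y : rnorm (U (delta R x) y) <= d.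
  by rewrite leNgt; apply/negP => /ltW h; apply: peak; exists y.
have [B [uB sB] hB] := hN x.
set xi := U (delta R x) in peak.
have xi1 : rnorm xi = 1 by rewrite (spatial_rnorm _ sUV) rnorm_delta.
have [|s us hs] := @l2_tail _ _ xi (1 / 4); first by rewrite divr_gt0.
pose p y := xi y *: delta R y.
pose v y := restr [set` B] (V (p y)).
have [b] := sign_choice v us.
have -> : \sum_(y <- s) (if b y then v y else - v y) =
    restr [set` B] (V (\sum_(y <- s) if b y then p y else - p y)).
  rewrite (linear_fun_sum _ _ lV).
  rewrite (linear_fun_sum _ _ (@restr_linear R X [set` B])).
  apply: eq_bigr => y _; case: ifP => // _.
  rewrite -[- p y]sub0r (linear_funB _ _ lV) (linear_fun0 lV).
  by rewrite restrB restr0 sub0r.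
set t := \sum_(y <- s) (if _ then _ else _) => hb.
have {}hb : rnorm (restr [set` B] (V t)) ^+ 2 <= (1 / 4) ^+ 2.
  apply: le_trans hb _.
  (* Summed over [y] first, the squared coordinates of [U delta_z] give at most 1 for each of the at
     most [N] points [z] of the ball. *)
  apply: (@le_trans _ _ (\sum_(y <- s) d ^+ 2 *
      \sum_(z <- B) rnorm (U (delta R z) y) ^+ 2)).
    apply: ler_sum => y _.
    rewrite /v /p (linear_funZ _ _ lV) restrZ rnormZ exprMn.
    apply: ler_pM; rewrite ?sqr_ge0//.
      by rewrite ler_sqr ?nnegrE ?rnorm_ge0// (le_trans (rnorm_ge0 _) (peak y)).
    apply: le_trans (restr_seq_sqr _ uB) _.
    by apply: ler_sum => z _; rewrite spatial_coord.
  rewrite -mulr_sumr exchange_big/=.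
  apply: (@le_trans _ _ (d ^+ 2 * N%:R)).
    rewrite ler_wpM2l ?sqr_ge0//.
    apply: (@le_trans _ _ (\sum_(z <- B) 1)).
      apply: ler_sum => z _; apply: le_trans (sum_le_rnorm _ us) _.
      by rewrite (spatial_rnorm _ sUV) rnorm_delta expr1n.
    by rewrite big_const_seq count_predT iter_addr_0 ler_nat.
  rewrite /d exprVn -ler_pdivlMl ?invr_gt0 ?exprn_gt0 ?mulr_gt0 ?ltr_wpDl//.
  rewrite invrK; nra.
have {}hb : rnorm (restr [set` B] (V t)) <= 1 / 4.
  by rewrite -ler_sqr ?nnegrE ?rnorm_ge0// divr_ge0.
(* A signed sum is a difference of two restrictions of [xi]. Tightness with error [1 / 8] applies to
   both, although the sets depend on [x]. *)
have tE : t = restr [set` [seq y <- s | b y]] xi -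
              restr [set` [seq y <- s | ~~ b y]] xi.
  rewrite !restr_seq ?filter_uniq// !big_filter /t (bigID b)/=; congr (_ + _).
    by apply: eq_bigr => y ->.
  by rewrite -sumrN; apply: eq_bigr => y /negbTE ->.
have hf : rnorm (restr (~` [set` B]) (V t)) <= 1 / 4.
  have -> : ~` [set` B] = far r x.
    apply/seteqP; split=> y; rewrite /far /=.
      by move=> yB; rewrite ltNge; apply/negP => /hB.
    by rewrite ltNge => /negP h /hB.
  rewrite tE (linear_funB _ _ lV) restrB; apply: le_trans (rnormB _ _) _.
  by apply: le_trans (lerD (hr _ _) (hr _ _)) quarter.
have ht : rnorm (restr [set` s] xi) <= rnorm t.
  apply: rnorm_le => y; rewrite tE l2B !restrE.
  have [ys|ys] := boolP (y \in s); last first.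
    by rewrite memNset ?rnorm0 ?rnorm_ge0//; exact/negP.
  rewrite mem_set//; have [yb|yb] := boolP (b y).
    rewrite [y \in [set` [seq y <- s | b y]]]mem_set ?memNset ?subr0//=
      mem_filter.
      by rewrite yb.
    by rewrite yb ys.
  by rewrite memNset ?mem_set ?sub0r ?rnormN//= mem_filter ?(negbTE yb).
have h1 : rnorm xi <= rnorm (restr [set` s] xi) + 1 / 4.
  by rewrite -{1}(restrC [set` s] xi) (le_trans (rnormD _ _))// lerD2l.
have h2 : rnorm (V t) <= 1 / 2.
  rewrite -(restrC [set` B] (V t)); apply: le_trans (rnormD _ _) _.
  by apply: le_trans (lerD hb hf) half.
rewrite (spatial_rnorm _ (spatial_sym sUV)) in h2.
rewrite xi1 in h1.
exact: contra (le_trans h1 (lerD (le_trans ht h2) (lexx _))).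
Qed.

(** [U 1_{x} V] sends [delta_(f x)] to a multiple of [U delta_x] by a coefficient of modulus at
    least [d]. Tightness with error [d * e] at [f x] is divided by this coefficient. *)
Lemma spatial_concentration (f : X -> Y) (d : R) : 0 < d ->
  (forall x, d <= rnorm (U (delta R x) (f x))) ->
  forall e : R, 0 < e -> exists2 r : R, 0 <= r &
    forall x, rnorm (restr (far r (f x)) (U (delta R x))) <= e.
Proof.
move=> d0 fd e e0.
have [|r r0 hr] := @uniform_tight _ _ _ _ _ (spatial_sym sUV) (d * e).
  by rewrite mulr_gt0.
exists r => // x; have := hr [set x] (f x).
rewrite restr_set1 (linear_funZ _ _ lU) restrZ rnormZ spatial_coord => h.
rewrite -(ler_pM2l d0); apply: le_trans h.
by rewrite ler_wpM2r ?rnorm_ge0.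
Qed.

End Peak.

(** * Composition with a map of bounded displacement *)

Section CompositionOperator.
Variables (R : realType) (X : metricType R).

(** The terms are grouped by the value of [t], each value being taken at most [N] times. *)
Lemma sum_comp_le (t : X -> X) (N : nat) (a : X -> R) (s : seq X) : uniq s ->
  (forall x, 0 <= a x) ->
  (forall z, (size [seq x <- s | t x == z] <= N)%N) ->
  \sum_(x <- s) a (t x) <= N%:R * \sum_(z <- undup (map t s)) a z.
Proof.
move=> us a0 tN; rewrite mulr_sumr.
have -> : \sum_(x <- s) a (t x) =
    \sum_(x <- s) \sum_(z <- undup (map t s)) if t x == z then a z else 0.
  apply: eq_big_seq => x xs.
  rewrite (bigD1_seq (t x)) ?undup_uniq//=; last by rewrite mem_undup map_f.
  by rewrite eqxx big1 ?addr0// => z; rewrite eq_sym => /negbTE ->.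
rewrite exchange_big/=; apply: ler_sum => z _.
rewrite -big_mkcond -big_filter big_const_seq count_predT iter_addr_0.
by rewrite -[a z *+ _]mulr_natl ler_wpM2r// ler_nat.
Qed.

(** On basis vectors this sends [delta z] to the indicator of the fibre of [t] over [z]. Fibres of
    bounded size are what makes it a bounded operator. *)
Definition comp_op (t : X -> X) (u : l2 R X) : l2 R X :=
  l2_of (fun x => u (t x)).

Variables (t : X -> X) (r : R).
Hypothesis ulf : uniformly_locally_finite (metric_coarse X).
Hypothesis tr : forall x, mdist x (t x) <= r.

Let comp_bound : exists N : nat, forall (u : l2 R X) (s : seq X), uniq s ->
  \sum_(x <- s) rnorm (u (t x)) ^+ 2 <= N%:R * rnorm u ^+ 2.
Proof.
have [N hN] := ulf_ball ulf r; exists N => u s us.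
apply: le_trans (sum_comp_le (t := t) (N := N)
  (a := fun x => rnorm (u x) ^+ 2) us _ _) _.
- by move=> x; exact: sqr_ge0.
- move=> z; have [B [uB sB] hB] := hN z; apply: leq_trans sB.
  apply: uniq_leq_size; first exact: filter_uniq.
  move=> x; rewrite mem_filter => /andP[/eqP tx _].
  by apply/hB; rewrite metric_sym -tx.
- by apply: ler_wpM2l (sum_le_rnorm u (undup_uniq _)).
Qed.

Lemma comp_opE u x : comp_op t u x = u (t x).
Proof.
have [N hN] := comp_bound; rewrite l2_ofE//.
apply: (@in_l2 _ _ _ (N%:R * rnorm u ^+ 2)) => [|s us]; last exact: hN.
by rewrite mulr_ge0// sqr_ge0.
Qed.

Lemma comp_op_roe : uniform_roe (metric_coarse X) (comp_op t).
Proof.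
have [N hN] := comp_bound.
apply: finite_propagation_roe.
  apply/bounded_operatorP; split.
    by move=> c u v; apply: l2P => x; rewrite l2D l2Z !comp_opE l2D l2Z.
  (* [N] bounds the square of the norm, and [N <= (N + 1) ^+ 2] avoids a square root. *)
  exists (N%:R + 1) => [|u]; first exact: addr_ge0.
  apply: rnorm_le_sum => [|s us].
    by rewrite mulr_ge0 ?rnorm_ge0// addr_ge0.
  under eq_bigr do rewrite comp_opE.
  apply: le_trans (hN u s us) _.
  rewrite exprMn ler_wpM2r ?sqr_ge0// expr2.
  apply: (@le_trans _ _ (N%:R + 1)); first by rewrite lerDl.
  by rewrite ler_peMr ?lerDr// addr_ge0.
have r0 : 0 <= Num.max r 0 by rewrite le_max lexx orbT.
apply: (supp_coarse r0) => z x; rewrite comp_opE deltaE le_max.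
by have [<-|_] := eqVneq (t x) z; rewrite ?eqxx// metric_sym tr.
Qed.

End CompositionOperator.

(** * Coarseness and closeness of the peak maps *)

Section Coarse.
Variable R : realType.

Lemma dot_disjoint (X : choiceType) (u v : l2 R X) :
  (forall x, u x = 0 \/ v x = 0) -> l2_dot u v = 0.
Proof.
move=> uv; have -> : l2_dot u v = l2_dot 0 v.
  rewrite /l2_dot; congr csum; apply/funext => x.
  by case: (uv x) => ->; rewrite ?l20 ?rmorph0 ?mulr0 ?mul0r.
by rewrite -(scale0r (0 : l2 R X)) l2_dotZl mul0r.
Qed.

Lemma seq_argmax (T : eqType) (h : T -> R) (s : seq T) x0 : x0 \in s ->
  exists2 x, x \in s & forall y, y \in s -> h y <= h x.
Proof.
elim: s x0 => // a s IH x0 _; case: s IH => [_|b s IH].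
  by exists a; [rewrite mem_head | move=> y; rewrite inE => /eqP ->].
have [x xs hx] := IH b (mem_head b s).
have [ax|xa] := leP (h a) (h x).
  exists x; first by rewrite inE xs orbT.
  by move=> y; rewrite inE => /orP[/eqP ->//|/hx].
exists a; first exact: mem_head.
move=> y; rewrite inE => /orP[/eqP ->//|/hx h1]; exact: le_trans (ltW xa).
Qed.

Variables (X Y : metricType R) (U : l2 R X -> l2 R Y) (V : l2 R Y -> l2 R X).
Hypothesis sUV : spatial U V.

Let near (Z : metricType R) (r : R) (z : Z) : set Z := [set w | mdist z w <= r].

Let far_near (Z : metricType R) (r : R) (z : Z) : ~` near r z = far r z.
Proof.
apply/seteqP; split=> w; rewrite /near /far/= ltNge; first by move/negP.
by move/negP.
Qed.

Let near_dot (S : l2 R Y -> l2 R Y) (r s : R) (y y' : Y) (u u' : l2 R Y) :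
  uniformly_locally_finite (metric_coarse Y) -> linear S ->
  (forall z z', S (delta R z) z' != 0 -> mdist z z' <= s) ->
  r + s + r < mdist y y' ->
  l2_dot (S (restr (near r y) u)) (restr (near r y') u') = 0.
Proof.
move=> ulf lS Ss yy'; apply: dot_disjoint => z.
have [zy'|zy'] := boolP (z \in near r y'); last first.
  by right; rewrite restrE (negbTE zy').
(* The ball is finite, so the restricted vector is a finite combination of basis vectors and
   linearity alone reduces to the support of [S]. *)
left; have [N hN] := ulf_ball ulf r; have [B [uB _] hB] := hN y.
have -> : near r y = [set` B] by apply/seteqP; split=> w /hB.
rewrite restr_seq// (linear_fun_sum _ _ lS) l2_sum big1_seq// => w /andP[_ wB].
rewrite (linear_funZ _ _ lS) l2Z.
have [->|/Ss wz] := eqVneq (S (delta R w) z) 0; first by rewrite mulr0.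
move: zy' yy'; rewrite inE /near/= ltNge => zy' /negP; case.
apply: le_trans (metric_triangle y w y') _; rewrite -addrA; apply: lerD.
  exact/hB.
apply: le_trans (metric_triangle w z y') _; apply: lerD => //.
by rewrite metric_sym.
Qed.

(* Coarseness is tested on one operator of the algebra: composition with the map
   t sending x to the point of its r-ball whose image is farthest from f x. *)
Lemma spatial_coarse (f : X -> Y) :
  uniformly_locally_finite (metric_coarse X) ->
  uniformly_locally_finite (metric_coarse Y) ->
  (forall e : R, 0 < e -> exists2 r : R, 0 <= r &
    forall x, rnorm (restr (far r (f x)) (U (delta R x))) <= e) ->
  coarse_map (metric_coarse X) (metric_coarse Y) f.
Proof.
have half M : 0 <= M ->
    M * (4 * (M + 1))^-1 + M * (4 * (M + 1))^-1 <= 1 / 2 :> R.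
  move=> M0; rewrite -mulrDl.
  by rewrite -ler_pdivlMr ?invrK ?invr_gt0 ?mulr_gt0 ?ltr_wpDl//; lra.
have absurd1 : (1 : R) <= 1 / 4 + 1 / 2 -> False by lra.
move=> Xulf Yulf conc A /metric_coarseP [r r0 Ar].
have [N hN] := ulf_ball Xulf r.
have farthest x : exists z, mdist x z <= r /\
    forall w, mdist x w <= r -> mdist (f x) (f w) <= mdist (f x) (f z).
  have [B _ hB] := hN x; have xB : x \in B by apply/hB; rewrite mdistxx.
  have [z zB hz] := seq_argmax (fun z => mdist (f x) (f z)) xB.
  by exists z; split; [exact/hB | move=> w /hB /hz].
have [t ht] := choice farthest.
pose T := @comp_op R X t.
have rT : uniform_roe (metric_coarse X) T.
  exact: (comp_op_roe Xulf (fun x => (ht x).1)).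
have q0 : (0 : R) < 1 / 4 by rewrite divr_gt0.
have [S bS [s s0 [Ss TS]]] := roe_approx (spatial_roeU sUV rT) q0.
have [lS [M M0 SM]] := (bounded_operatorP S).1 bS.
(* Each of the two tail terms below is at most [M * e <= 1 / 4]. With the approximation error
   [1 / 4] they stay below 1. *)
pose e := (4 * (M + 1))^-1.
have e0 : 0 < e by rewrite invr_gt0 mulr_gt0// ltr_wpDl.
have [c c0 hc] := conc e e0.
have key x : mdist (f x) (f (t x)) <= c + s + c.
  rewrite leNgt; apply/negP; rewrite metric_sym => far_tx.
  pose u := U (delta R (t x)); pose v := U (delta R x).
  have u1 : rnorm u = 1 by rewrite (spatial_rnorm _ sUV) rnorm_delta.
  have v1 : rnorm v = 1 by rewrite (spatial_rnorm _ sUV) rnorm_delta.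
  (* This is the matrix coefficient of [T] from [t x] to [x], moved to [Y]. *)
  have d1 : l2_dot ((U \o T \o V) u) v = 1.
    rewrite /= (spatial_dot sUV) !(spatial_K sUV) dot_delta.
    by rewrite (comp_opE Xulf (fun x => (ht x).1)) deltaE eqxx.
  pose u1' := restr (near c (f (t x))) u; pose u2 := restr (far c (f (t x))) u.
  pose v1' := restr (near c (f x)) v; pose v2 := restr (far c (f x)) v.
  have uE : u = u1' + u2 by rewrite /u1' /u2 -far_near restrC.
  have vE : v = v1' + v2 by rewrite /v1' /v2 -far_near restrC.
  have z0 : l2_dot (S u1') v1' = 0 by apply: near_dot Yulf lS Ss far_tx.
  have d2 : l2_dot (S u) v = l2_dot (S u1') v2 + l2_dot (S u2) v.
    by rewrite {1}uE (linear_funD _ _ lS) l2_dotDl {1}vE l2_dotDr z0 add0r.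
  have h1 : rnorm (l2_dot (S u1') v2) <= M * e.
    apply: le_trans (rnorm_dot _ _) _; apply: ler_pM; rewrite ?rnorm_ge0//.
      by apply: le_trans (SM _) _; rewrite ler_piMr// -u1; exact: restr_le.
    exact: hc.
  have h2 : rnorm (l2_dot (S u2) v) <= M * e.
    apply: le_trans (rnorm_dot _ _) _; rewrite v1 mulr1.
    apply: le_trans (SM _) _; rewrite ler_wpM2l//; exact: hc.
  have h3 : rnorm (l2_dot ((U \o T \o V) u - S u) v) <= 1 / 4.
    apply: le_trans (rnorm_dot _ _) _; rewrite v1 mulr1.
    by apply: TS; rewrite u1.
  apply: absurd1; rewrite -[leLHS](rnorm1 R) -d1.
  rewrite -[(U \o T \o V) u](subrK (S u)) l2_dotDl d2.
  apply: le_trans (rnormD _ _) _; apply: lerD h3 _.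
  apply: le_trans (rnormD _ _) _; apply: le_trans (lerD h1 h2) _.
  exact: half.
exists [set yy | mdist yy.1 yy.2 <= c + s + c].
  by apply/metric_coarseP; exists (c + s + c) => //; rewrite !addr_ge0.
move=> x x' /Ar xx' /=; apply: le_trans (key x); exact: (ht x).2.
Qed.

(** [V delta_(f x)] has a coordinate of modulus at least [d] at [x], but norm at most [d / 2] off a
    ball about [g (f x)]. Hence [x] lies in that ball. *)
Lemma spatial_close (f : X -> Y) (g : Y -> X) (d : R) : 0 < d ->
  (forall x, d <= rnorm (U (delta R x) (f x))) ->
  (forall e : R, 0 < e -> exists2 r : R, 0 <= r &
    forall y, rnorm (restr (far r (g y)) (V (delta R y))) <= e) ->
  close_maps (metric_coarse X) (g \o f) id.
Proof.
move=> d0 fd conc; have d2 : 0 < d / 2 by rewrite divr_gt0.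
have [r r0 hr] := conc _ d2.
apply/metric_coarseP; exists r => // _ _ [x _ [<- <-]].
rewrite leNgt; apply/negP => /= rx.
have : d <= d / 2.
  apply: le_trans (fd x) _; rewrite -(spatial_coord sUV).
  apply: le_trans (hr (f x)); apply: le_trans (rnorm_coord _ x).
  by rewrite restrE mem_set.
by rewrite leNgt ltr_pdivrMr// ltr_pMr// ltr1n.
Qed.

End Coarse.

Theorem corollary1p2 (R : realType) (X Y : metricType R)
    (X_ulf : uniformly_locally_finite (metric_coarse X))
    (Y_ulf : uniformly_locally_finite (metric_coarse Y))
    (X_Hilbert : coarsely_embeds_in_Hilbert R (metric_coarse X))
    (Y_Hilbert : coarsely_embeds_in_Hilbert R (metric_coarse Y))
    (XY_roe : uniform_roe_isomorphic X Y) :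
  coarsely_equivalent (metric_coarse X) (metric_coarse Y).
Proof.
have [phi phi_iso] := XY_roe; have [U [V sUV]] := spatial_exists phi_iso.
have sVU := spatial_sym sUV.
have [d d0 /choice[f fd]] := spatial_peak sUV X_ulf.
have [d' d'0 /choice[g gd]] := spatial_peak sVU Y_ulf.
have cf := spatial_concentration sUV d0 fd.
have cg := spatial_concentration sVU d'0 gd.
exists f; split; first exact: spatial_coarse sUV _ X_ulf Y_ulf cf.
exists g; split.
- exact: spatial_coarse sVU _ Y_ulf X_ulf cg.
- exact: spatial_close sUV _ _ _ d0 fd cg.
- exact: spatial_close sVU _ _ _ d'0 gd cf.
Qed.
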